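(* Let $V(s)=V_k(s)+V_p(s)$ be the total energy of the dynamical system $\dot s=\mathcal F(s)$ given in the context, where $V_k$ is the total kinetic energy and $V_p$ is the total potential energy. Assume that at least three of the points $x_1,\dots,x_N$ are noncollinear. Then: (i) $V_p$ exactly recovers the objective function of the point cloud registration problem: for every state $s=(p,R,v,\omega)$, setting $t:=p-R\bar x$, $$V_p(s)=\sum_{i=1}^N\frac{1}{\sigma_i^2}\,\|y_i-Rx_i-t\|^2 .$$ (ii) All trajectories of the system globally asymptotically converge to the set of equilibrium points $\mathcal E=\{s:\mathcal F(s)=0\}$; that is, for every initial state in $\mathbb R^3\times\mathrm{SO}(3)\times\mathbb R^3\times\mathbb R^3$, the corresponding trajectory satisfies $\operatorname{dist}(s(\tau),\mathcal E)\to 0$ as time $\tau\to\infty$. Moreover, at every point $s=(p,R,v,\omega)\in\mathcal E$, the total force and the total torque both vanish, $f(s)=0$ and $T(s)=0$, and the origins of the two frames align, i.e. $p=\bar y=0$.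
   Context: Data. Let $x_1,\dots,x_N,y_1,\dots,y_N\in\mathbb R^3$ and $\sigma_1,\dots,\sigma_N>0$. Put $m_i=1/\sigma_i^2$ (masses), $k_i=2/\sigma_i^2$ (spring coefficients), $M=\sum_{i=1}^N m_i$, $\bar x=\frac1M\sum_i m_ix_i$, $\bar y=\frac1M\sum_i m_iy_i$, $\tilde x_i=x_i-\bar x$, and let $\mu>0$ be a constant (viscous damping coefficient). It is assumed throughout that $\bar y=0$. For $a\in\mathbb R^3$, $[a]_\times$ denotes the $3\times3$ skew-symmetric matrix with $[a]_\times b=a\times b$ for all $b\in\mathbb R^3$. The registration problem is to minimize $\sum_{i=1}^N\frac1{\sigma_i^2}\|y_i-Rx_i-t\|^2$ over $R\in\mathrm{SO}(3)$, $t\in\mathbb R^3$. State. A state is $s=(p,R,v,\omega)\in\mathbb R^3\times\mathrm{SO}(3)\times\mathbb R^3\times\mathbb R^3$ ($p$: position of the center of mass of the moving point cloud, $R$: its orientation, $v$: velocity of its center of mass, $\omega$: body-frame angular velocity). The state space is viewed as a subset of $\mathbb R^{18}$ (vectorizing $R$) with the Euclidean distance. The $i$-th particle has position $R\tilde x_i+p$ and velocity $v+R(\omega\times\tilde x_i)$. Force, torque, inertia. $$f(s)=\sum_{i=1}^N k_i\,(y_i-R\tilde x_i-p)-\mu Mv,$$ $$T(s)=\sum_{i=1}^N\Big(k_i[\tilde x_i]_\times R^{\mathsf T}(y_i-p)-\mu m_i[\tilde x_i]_\times[\omega]_\times\tilde x_i\Big),\qquad J=-\sum_{i=1}^N m_i[\tilde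 x_i]_\times^2 .$$ When at least three of the $x_i$ are noncollinear, $J$ is symmetric positive definite. Dynamics. The system $\dot s=\mathcal F(s)$ is $$\dot p=v,\qquad \dot R=R[\omega]_\times,\qquad M\dot v=f(s),\qquad J\dot\omega=T(s)-\omega\times J\omega .$$ Energies. $V_k(s)=\sum_{i=1}^N\frac{m_i}{2}\|v+R(\omega\times\tilde x_i)\|^2$ is the kinetic energy of the particles, and $V_p(s)=\sum_{i=1}^N\frac{k_i}{2}\|y_i-R\tilde x_i-p\|^2$ is the potential energy of the springs. *)

(* Defs.v *)
From mathcomp Require Import all_boot all_order all_algebra.
From mathcomp Require Import all_classical all_reals all_analysis.

Set Implicit Arguments.
Unset Strict Implicit.
Unset Printing Implicit Defensive.

Import Order.TTheory GRing.Theory Num.Theory.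
Import numFieldNormedType.Exports.

Local Open Scope classical_set_scope.
Local Open Scope ring_scope.

Section Geometry.
Variable R : realType.

(* The library norm on matrices is the max norm; this is the Euclidean norm of
   the vector of entries (Frobenius norm). *)
Definition l2norm m n (A : 'M[R]_(m, n)) : R :=
  Num.sqrt (\sum_i \sum_j A i j ^+ 2).

(* Indices are taken cyclically: addition in 'I_3 is modulo 3. *)
Definition cross (a b : 'cV[R]_3) : 'cV[R]_3 :=
  \col_(i < 3) (a (i + 1) 0 * b (i + 2) 0 - a (i + 2) 0 * b (i + 1) 0).

(* [a]_x: its j-th column is the cross product of a with the j-th basis
   vector. *)
Definition skew (a : 'cV[R]_3) : 'M[R]_3 :=
  \matrix_(i, j) cross a (delta_mx j 0) i 0.

Lemma skewP (a b : 'cV[R]_3) : skew a *m b = cross a b.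
Proof.
apply/colP => i; rewrite !mxE.
under eq_bigr => j _ do rewrite !mxE !andbT mulrBl -!mulrA !mulr_natl !mulrb.
rewrite sumrB -!mulr_sumr.
congr (_ * _ - _ * _); rewrite -big_mkcond;
  by apply: big_pred1 => j; rewrite eq_sym.
Qed.

Definition SO3 : set 'M[R]_3 := [set Q | Q^T *m Q = 1%:M /\ \det Q = 1].

Definition collinear (a b c : 'cV[R]_3) : Prop :=
  exists o d : 'cV[R]_3, forall z, z \in [:: a; b; c] ->
    exists r : R, z = o + r *: d.

End Geometry.

Arguments SO3 {R}.

Section State.
Variable R : realType.

(* s = (p, Q, v, w), the ambient space R^18; the constraint on the orientation
   Q is imposed by state_space. *)
Definition state : Type := ('cV[R]_3 * 'M[R]_3 * 'cV[R]_3 * 'cV[R]_3)%type.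

Definition st_pos (s : state) : 'cV[R]_3 := s.1.1.1.
Definition st_rot (s : state) : 'M[R]_3 := s.1.1.2.
Definition st_vel (s : state) : 'cV[R]_3 := s.1.2.
Definition st_angvel (s : state) : 'cV[R]_3 := s.2.

Definition state_space : set state := [set s | SO3 (st_rot s)].

Definition state_dist (s s' : state) : R :=
  Num.sqrt (l2norm (st_pos s - st_pos s') ^+ 2
          + l2norm (st_rot s - st_rot s') ^+ 2
          + l2norm (st_vel s - st_vel s') ^+ 2
          + l2norm (st_angvel s - st_angvel s') ^+ 2).

(* Extended-real valued, so that the distance to the empty set is +oo. *)
Definition state_dist_set (s : state) (A : set state) : \bar R :=
  ereal_inf [set (state_dist s a)%:E | a in A].

End State.

Arguments state_space {R}.

Record registration (R : realType) (N : nat) := Registration {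
  src : 'I_N -> 'cV[R]_3;
  tgt : 'I_N -> 'cV[R]_3;
  sigma : 'I_N -> R;
  mu : R
}.

Section Dynamics.
Variables (R : realType) (N : nat) (D : registration R N).
Local Notation x := (src D).
Local Notation y := (tgt D).

Definition mass (i : 'I_N) : R := 1 / sigma D i ^+ 2.
Definition spring (i : 'I_N) : R := 2 / sigma D i ^+ 2.
Definition total_mass : R := \sum_i mass i.

Definition src_center : 'cV[R]_3 := total_mass^-1 *: \sum_i mass i *: x i.
Definition tgt_center : 'cV[R]_3 := total_mass^-1 *: \sum_i mass i *: y i.
Definition src_rel (i : 'I_N) : 'cV[R]_3 := x i - src_center.

Definition particle_vel (s : state R) (i : 'I_N) : 'cV[R]_3 :=
  st_vel s + st_rot s *m cross (st_angvel s) (src_rel i).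

Definition force (s : state R) : 'cV[R]_3 :=
  \sum_i spring i *: (y i - st_rot s *m src_rel i - st_pos s)
  - (mu D * total_mass) *: st_vel s.

Definition torque (s : state R) : 'cV[R]_3 :=
  \sum_i (spring i *: (skew (src_rel i) *m (st_rot s)^T *m (y i - st_pos s))
          - (mu D * mass i) *:
              (skew (src_rel i) *m skew (st_angvel s) *m src_rel i)).

Definition inertia : 'M[R]_3 :=
  - \sum_i mass i *: (skew (src_rel i) *m skew (src_rel i)).

(* The dynamics M v' = f(s), J w' = T(s) - w x J w, solved for the derivatives;
   M > 0 and J is invertible as soon as three source points are noncollinear. *)
Definition vector_field (s : state R) : state R :=
  (st_vel s,
   st_rot s *m skew (st_angvel s),
   total_mass^-1 *: force s,
   invmx inertia *m
     (torque s - cross (st_angvel s) (inertia *m st_angvel s))).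

Definition equilibria : set (state R) :=
  [set s | state_space s /\ vector_field s = 0].

(* Only the values s tau for 0 <= tau matter; the derivative at time 0 is
   one-sided. *)
Definition trajectory (s0 : state R) (s : R -> state R) : Prop :=
  [/\ s 0 = s0,
      forall tau : R, 0 <= tau -> state_space (s tau),
      h^-1 *: (s h - s 0) @[h --> (0 : R)^'+] --> vector_field (s 0) &
      forall tau : R, 0 < tau -> is_derive tau 1 s (vector_field (s tau))].

Definition kinetic_energy (s : state R) : R :=
  \sum_i mass i / 2 * l2norm (particle_vel s i) ^+ 2.

Definition potential_energy (s : state R) : R :=
  \sum_i spring i / 2 * l2norm (y i - st_rot s *m src_rel i - st_pos s) ^+ 2.

Definition total_energy (s : state R) : R :=
  kinetic_energy s + potential_energy s.

End Dynamics.

(* Main.v *)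
Require Import Defs.
From HB Require Import structures.
From mathcomp Require Import all_boot all_order all_algebra.
From mathcomp Require Import all_classical all_reals all_analysis.
From mathcomp Require Import ring lra.

(* The translational part decouples, v' = - 2 p - mu v, and the torque is
   tau(Q) - mu J w with tau(Q) = sum_i k_i [x_i]_x Q^T y_i.  The total energy H
   is coercive on the state space and H' = - mu (M |v|^2 + w . J w).  Solutions
   exist for all times: cut the field off by a scalar factor to make it globally
   Lipschitz, and observe that the factor changes neither the constraint nor the
   sign of H', so that the solution stays where the factor is 1.

   For the convergence no invariance principle is needed: if f converges and f'
   is Lipschitz then f' -> 0.  Applied to H, this gives v, w -> 0; applied to
   the coordinates of v and w, it gives v', w' -> 0.  Hence the defect
   |v|^2 + |w|^2 + |v'|^2 + |w'|^2 tends to 0 along a bounded trajectory, and by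
   compactness a bounded state with a small defect is close to a zero of the
   defect, that is, to an equilibrium. *)

Set Implicit Arguments.
Unset Strict Implicit.
Unset Printing Implicit Defensive.

Import Order.TTheory GRing.Theory Num.Theory.
Import numFieldNormedType.Exports.

Local Open Scope classical_set_scope.
Local Open Scope ring_scope.

(** * Calculus on the half line, Picard's theorem, limits at infinity *)

Section RealAnalysis.
Variable R : realType.
Implicit Types (f g df dg : R -> R) (t s K : R).

Lemma is_derive_continuous f t d : is_derive t 1 f d -> {for t, continuous f}.
Proof.
by move=> [df _]; apply/differentiable_continuous/derivable1_diffP.
Qed.

Lemma MVT_is_derive f df (a b : R) : a <= b ->
  (forall t, a <= t <= b -> is_derive t 1 f (df t)) ->
  exists2 c, a <= c <= b & f b - f a = df c * (b - a).
Proof.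
move=> ab H.
have [|| c] := @MVT_segment R f df a b ab.
- by move=> t; rewrite in_itv /= => /andP[at_ tb]; apply: H; rewrite !ltW.
- apply: continuous_in_subspaceT => t; rewrite inE /= in_itv /= => Ht.
  exact: is_derive_continuous (H _ Ht).
by rewrite in_itv /=; exists c.
Qed.

Lemma antiderivative f : continuous f ->
  exists A : R -> R, A 0 = 0 /\ forall t, 0 <= t -> is_derive t 1 A (f t).
Proof.
move=> cf.
(* The integral starts at -1, so that 0 is an interior point and the derivative at time 0 is
   two-sided. *)
pose B x := (\int[@lebesgue_measure R]_(t in [set` `[-1, x]]) (f t))%R.
exists (fun x => B x - B 0); split; first by rewrite subrr.
move=> t t0.
have fi : (@lebesgue_measure R).-integrable `[-1, t + 1] (EFin \o f).
  apply: continuous_compact_integrable; first exact: segment_compact.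
  exact: continuous_subspaceT.
have [|||dB B'] := @continuous_FTC1_closed R f (-1) t (t + 1) _ fi.
- by rewrite ltrDl.
- by rewrite (lt_le_trans _ t0)// ltrN10.
- exact: cf.
have HB : is_derive t 1 B (f t).
  by split; [exact: dB|rewrite -derive1E; exact: B'].
rewrite -[X in is_derive _ _ _ X]subr0.
exact: is_deriveB.
Qed.

(** By the mean value theorem, [g - f] and [g + f] both stay nonnegative; the sign [e] treats them
    at once. *)
Lemma derive_norm_le f g df dg :
    (forall t, 0 <= t -> is_derive t 1 f (df t)) ->
    (forall t, 0 <= t -> is_derive t 1 g (dg t)) ->
    (forall t, 0 <= t -> `|df t| <= dg t) -> `|f 0| <= g 0 ->
  forall t, 0 <= t -> `|f t| <= g t.
Proof.
move=> Hf Hg Hd H0 t t0.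
have H (e : R) : e = 1 \/ e = -1 -> e * f t <= g t.
  move=> He.
  have [|c /andP[c0 _]] := @MVT_is_derive (fun x => g x - e * f x)
    (fun x => dg x - e * df x) 0 t t0.
    move=> x /andP[x0 _]; have := Hf _ x0; have := Hg _ x0 => ? ?.
    exact: is_deriveB.
  have := Hd _ c0; move: H0; rewrite !ler_norml => /andP[? ?] /andP[? ?] E.
  have : 0 <= (dg c - e * df c) * (t - 0).
    by rewrite subr0 mulr_ge0 //; case: He => ->; lra.
  by rewrite -E; case: He => ->; lra.
rewrite ler_norml; have := H 1 (or_introl erefl).
have := H (-1) (or_intror erefl).
by rewrite mul1r mulN1r => ? ?; apply/andP; split; lra.
Qed.

Lemma derive_bounded_lipschitz f df K (a : R) :
    (forall t, a <= t -> is_derive t 1 f (df t)) ->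
    (forall t, a <= t -> `|df t| <= K) ->
  forall t s, a <= t -> a <= s -> `|f t - f s| <= K * `|t - s|.
Proof.
move=> Hf Hd.
suff H t s : a <= s -> s <= t -> `|f t - f s| <= K * `|t - s|.
  move=> t s t0 s0; have [st|/ltW ts] := leP s t; first exact: H.
  by rewrite distrC (distrC t); exact: H.
move=> s0 st; have [|c /andP[c0 _] ->] := @MVT_is_derive f df s t st.
  by move=> x /andP[x0 _]; apply: Hf; exact: le_trans x0.
by rewrite normrM ler_wpM2r // Hd //; exact: le_trans c0.
Qed.

Lemma lipschitz_continuous f K :
  (forall t s, `|f t - f s| <= K * `|t - s|) -> continuous f.
Proof.
move=> H t; apply/cvgrPdist_le => /= e e0; near=> s.
apply: (le_trans (H _ _)).
have K0 : 0 < `|K| + 1 by rewrite ltr_wpDl.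
apply: (@le_trans _ _ ((`|K| + 1) * `|t - s|)).
  by rewrite ler_wpM2r // (le_trans (ler_norm _)) // lerDl.
rewrite -ler_pdivlMl //; near: s.
by apply: cvgr_dist_le; [exact: cvg_id | rewrite mulr_gt0 ?invr_gt0].
Unshelve. all: by end_near. Qed.

Lemma le_geometric_half (x y C : R) :
  (forall n, x <= y + C * 2^-1 ^+ n) -> x <= y.
Proof.
move=> H; have h : (y + C * 2^-1 ^+ n @[n --> \oo] --> y + C * 0)%R.
  apply: cvgD; first exact: cvg_cst.
  apply: cvgMr; apply: cvg_expr; rewrite ger0_norm ?invr_ge0 //; lra.
rewrite mulr0 addr0 in h.
by apply: (cvgr_to_ge h); near=> n; exact: H.
Unshelve. all: by end_near. Qed.

(** The intervals of center [x n] and radius [2 * C * 2^-1 ^+ n] are nested: halving the radius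
    frees exactly the length of one step. The supremum of the left ends lies in all of them. *)
Lemma geometric_half_limit (x : nat -> R) (C : R) :
    (forall n, `|x n.+1 - x n| <= C * 2^-1 ^+ n) ->
  exists l : R, forall n, `|x n - l| <= 2 * C * 2^-1 ^+ n.
Proof.
move=> H; pose lo n := x n - 2 * C * 2^-1 ^+ n.
pose hi n := x n + 2 * C * 2^-1 ^+ n.
have loS n : lo n <= lo n.+1.
  by rewrite /lo exprS; have := H n; rewrite ler_norml => /andP[]; lra.
have hiS n : hi n.+1 <= hi n.
  by rewrite /hi exprS; have := H n; rewrite ler_norml => /andP[]; lra.
have lohi n : lo n <= hi n.
  have : 0 <= C * 2^-1 ^+ n by exact: le_trans (normr_ge0 _) (H n).
  rewrite /lo /hi; lra.
have lo_hi n m : lo n <= hi m.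
  have Hl a b : (a <= b)%N -> lo a <= lo b.
    elim: b => [|b IH]; first by rewrite leqn0 => /eqP ->.
    rewrite leq_eqVlt => /predU1P[->//|]; rewrite ltnS => /IH /le_trans; exact.
  have Hh a b : (a <= b)%N -> hi b <= hi a.
    elim: b => [|b IH]; first by rewrite leqn0 => /eqP ->.
    rewrite leq_eqVlt => /predU1P[->//|]; rewrite ltnS => /IH.
    exact/le_trans.
  apply: le_trans (Hl _ _ (leq_maxl n m)) _.
  exact: le_trans (lohi _) (Hh _ _ (leq_maxr n m)).
have hs : has_sup (range lo).
  by split; [exists (lo 0), 0|exists (hi 0); move=> _ [n _ <-]].
exists (sup (range lo)) => n.
have : lo n <= sup (range lo) by apply: ub_le_sup; [exact: hs.2|exists n].
have : sup (range lo) <= hi n by apply: ge_sup; [exact: hs.1|move=> _ [m _ <-]].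
rewrite /lo /hi ler_norml => ? ?; apply/andP; split; lra.
Qed.

(** Picard iteration, coordinate by coordinate with constants uniform in [i]. The bound on [G] keeps
    each iterate [K]-Lipschitz in time, so that the next integrand is continuous; the exponential
    weight makes the solution global at once. *)
Lemma picard (I : Type) (G : (I -> R) -> I -> R) K (a : I -> R) :
    (forall b c (r : R), (forall i, `|b i - c i| <= r) ->
       forall i, `|G b i - G c i| <= K * r) ->
    (forall b i, `|G b i| <= K) -> 0 < K ->
  exists u : R -> I -> R, u 0 = a /\
    forall t, 0 <= t -> forall i, is_derive t 1 (u^~ i) (G (u t) i).
Proof.
move=> Glip Gbd K0.
(* [A] picks an antiderivative of each continuous function, and the default [cst 0] elsewhere, which
   makes [Phi] total. *)
have /choice[A HA] : forall g : R -> R, exists A : R -> R, continuous g ->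
    A 0 = 0 /\ forall t, 0 <= t -> is_derive t 1 A (g t).
  move=> g; have [/antiderivative[A ?]|ng] := pselect (continuous g).
    by exists A.
  by exists (cst 0).
pose lip (v : R -> I -> R) := forall t s i, 0 <= t -> 0 <= s ->
  `|v t i - v s i| <= K * `|t - s|.
(* [lip] says nothing at negative times, while [A] wants continuity on the whole line; [Num.max s 0]
   freezes [v] before time 0. *)
pose Phi (v : R -> I -> R) t i := a i + A (fun s => G (v (Num.max s 0)) i) t.
have Phi0 v i : lip v -> continuous (fun s => G (v (Num.max s 0)) i).
  move=> vlip; apply: (@lipschitz_continuous _ (K * K)) => t s.
  rewrite -mulrA; apply: Glip => j.
  have ge0 (x : R) : 0 <= Num.max x 0 by rewrite le_max lexx orbT.
  apply: le_trans (vlip _ _ _ (ge0 t) (ge0 s)) _; rewrite ler_pM2l //.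
  rewrite /Order.max; do 2 case: ltrP => ?; rewrite ?subrr ?normr0 ?normr_ge0 //.
    by rewrite sub0r normrN ger0_norm // distrC (le_trans _ (ler_norm _)); lra.
  by rewrite subr0 ger0_norm // (le_trans _ (ler_norm _)); lra.
have PhiE v i : lip v -> Phi v 0 i = a i.
  by move=> /(Phi0 _ i)/HA[A0 _]; rewrite /Phi A0 addr0.
have PhiD v i t : lip v -> 0 <= t -> is_derive t 1 ((Phi v)^~ i) (G (v t) i).
  move=> /(Phi0 _ i)/HA[_ dA] t0; have := dA _ t0; rewrite max_l // => ?.
  by rewrite -[X in is_derive _ _ _ X]add0r; exact: is_deriveD.
have Phi_lip v : lip v -> lip (Phi v).
  move=> vlip t s i; apply: (@derive_bounded_lipschitz (Phi v ^~ i)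
    (fun t => G (v t) i)) => // x x0; exact: PhiD.
pose E t := expR (2 * K * t).
have dE c t : is_derive t 1 (fun t => c * E t) (c * (2 * K * E t)).
  rewrite /E; apply: is_derive_eq; rewrite /GRing.scale /=; ring.
have E1 t : 0 <= t -> 1 <= E t.
  by move=> t0; rewrite -expR0 ler_expR mulr_ge0 // mulr_ge0 // ltW.
(* With the weight [E], each Picard step gains a factor 1/2. *)
have contract v v' c : lip v -> lip v' -> 0 <= c ->
    (forall t i, 0 <= t -> `|v t i - v' t i| <= c * E t) ->
  forall t i, 0 <= t -> `|Phi v t i - Phi v' t i| <= c / 2 * E t.
  move=> lv lv' c0 H t i.
  apply: (@derive_norm_le (fun t => Phi v t i - Phi v' t i)
    (fun t => c / 2 * E t) (fun t => G (v t) i - G (v' t) i)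
    (fun t => c / 2 * (2 * K * E t))) => [x x0|x x0|].
  - by apply: is_deriveB; exact: PhiD.
  - have -> : c / 2 * (2 * K * E x) = K * (c * E x) by field.
    by apply: Glip => j; exact: H.
  - by rewrite !PhiE // subrr normr0 mulr_ge0 ?expR_ge0 // divr_ge0.
pose u := fix u n : R -> I -> R := if n is n'.+1 then Phi (u n') else fun=> a.
have u_lip n : lip (u n).
  elim: n => [|n IH]; last exact: Phi_lip.
  by move=> t s i _ _; rewrite subrr normr0 mulr_ge0 // ltW.
have uS n t i : 0 <= t -> `|u n.+1 t i - u n t i| <= E t * 2^-1 ^+ n.
  rewrite mulrC; elim: n t i => [|n IH] t i t0; last first.
    rewrite exprSr.
    apply: (contract (u n.+1) (u n) _ (u_lip _) (u_lip _) _ IH t i t0).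
    by rewrite exprn_ge0 // invr_ge0.
  (* The first step: [|G| <= K <= 2 * K * E], which is the derivative of [E], since [E >= 1]. *)
  rewrite expr0; move: t t0.
  apply: (@derive_norm_le (fun t => Phi (u 0) t i - a i)
    (fun t => 1 * E t) (fun t => G (u 0 t) i)
    (fun t => 1 * (2 * K * E t))) => [x x0|x x0|].
  - rewrite -[X in is_derive _ _ _ X]subr0.
    by apply: is_deriveB; exact: PhiD.
  - apply: le_trans (Gbd _ _) _; rewrite mul1r.
    by have := E1 _ x0; rewrite -(ler_pM2l K0); lra.
  - by rewrite PhiE // subrr normr0 mul1r expR_ge0.
have /choice[w Hw] : forall t, exists w : I -> R, forall i, 0 <= t ->
    forall n, `|u n t i - w i| <= 2 * E t * 2^-1 ^+ n.
  move=> t; suff /choice[w Hw] : forall i, exists x : R, 0 <= t ->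
    forall n, `|u n t i - x| <= 2 * E t * 2^-1 ^+ n by exists w => i; exact: Hw.
  move=> i; have [t0|?] := leP 0 t; last by exists 0.
  have [n|x Hx] := @geometric_half_limit (fun n => u n t i) (E t).
    exact: uS.
  by exists x.
have w_lip : lip w.
  move=> t s i t0 s0; apply: (@le_geometric_half _ _ (2 * E t + 2 * E s)) => n.
  rewrite mulrDl; have := Hw t i t0 n; have := Hw s i s0 n.
  have := u_lip n t s i t0 s0.
  rewrite !ler_norml => /andP[? ?] /andP[? ?] /andP[? ?].
  by apply/andP; split; lra.
(* Both are within [E t * 2^-1 ^+ n] of [u n.+1 = Phi (u n)]: the first by contraction, the second
   by the choice of [w]. *)
have wE t : 0 <= t -> Phi w t = w t.
  move=> t0; apply/funext => i; apply/eqP; rewrite -subr_eq0 -normr_le0.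
  apply: (@le_geometric_half _ _ (2 * E t)) => n; rewrite add0r.
  have /(_ t i t0) H1 : forall t i, 0 <= t ->
      `|Phi w t i - Phi (u n) t i| <= (2 * 2^-1 ^+ n) / 2 * E t.
    apply: (contract _ _ _ w_lip (u_lip n)) => [|x j x0].
      by rewrite mulr_ge0 ?exprn_ge0 // invr_ge0.
    by rewrite distrC mulrAC; exact: Hw.
  have := Hw t i t0 n.+1; rewrite /= exprS; move: H1.
  rewrite !ler_norml => /andP[? ?] /andP[? ?].
  by apply/andP; split; lra.
(* The witness is [Phi w], not [w]: the values of [w] at negative times are arbitrary, and they
   would enter the derivative at 0. *)
exists (Phi w); split; first by apply/funext => i; exact: PhiE.
by move=> t t0 i; rewrite wE //; exact: PhiD.
Qed.

(* Landau's inequality: on a window of length h, the difference quotient of f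
   is within K h of its derivative. *)
Lemma derive_cvg0 f df K (a L : R) :
    (forall t, a <= t -> is_derive t 1 f (df t)) ->
    (forall t s, a <= t -> a <= s -> `|df t - df s| <= K * `|t - s|) ->
    f t @[t --> +oo] --> L ->
  df t @[t --> +oo] --> 0.
Proof.
move=> Hf Hd fL; apply/cvgrPdist_le => /= e e0.
pose M := `|K| + 1; have M0 : 0 < M by rewrite ltr_wpDl.
(* On a window of this length [df] varies by at most [M * h = e / 2]. If [f] is within [e * h / 4]
   of its limit at both ends, the difference quotient is also at most [e / 2]. *)
pose h := e / (2 * M); have h0 : 0 < h by rewrite divr_gt0 // mulr_gt0.
have : \forall t \near +oo, a <= t /\ `|L - f t| <= e * h / 4.
  near=> t; split; first by near: t; apply: nbhs_pinfty_ge; exact: num_real.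
  near: t; move/cvgrPdist_le : fL; apply.
  by rewrite divr_gt0 // mulr_gt0.
move=> [B [_ HB]]; near=> t; rewrite sub0r normrN.
have Bt : B < t by near: t; apply: nbhs_pinfty_gt; exact: num_real.
have [at_ ft] := HB _ Bt.
have [_ fth] : a <= t + h /\ `|L - f (t + h)| <= e * h / 4.
  by apply: HB; rewrite ltr_wpDr // ltW.
have tth : t <= t + h by rewrite lerDl ltW.
have [|c /andP[tc ch] E] := @MVT_is_derive f df t (t + h) tth.
  by move=> x /andP[tx _]; apply: Hf; exact: le_trans tx.
have H1 : `|df c - df t| <= e / 2.
  apply: le_trans (Hd _ _ _ _) _ => //; first exact: le_trans tc.
  apply: (@le_trans _ _ (M * h)).
    apply: (@le_trans _ _ (M * `|c - t|)).
      by rewrite ler_wpM2r // /M (le_trans (ler_norm _)) // lerDl.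
    by rewrite ler_pM2l // ger0_norm ?subr_ge0 // lerBlDl.
  by rewrite /h; have -> : M * (e / (2 * M)) = e / 2 by field; rewrite gt_eqF.
have H2 : `|df c| <= e / 2.
  rewrite -(ler_pM2r h0) -[X in _ * X <= _](ger0_norm (ltW h0)) -normrM.
  rewrite addrAC subrr add0r in E; rewrite -E.
  move: ft fth; rewrite !ler_norml => /andP[? ?] /andP[? ?].
  by apply/andP; split; lra.
move: H1 H2; rewrite !ler_norml => /andP[? ?] /andP[? ?].
by apply/andP; split; lra.
Unshelve. all: by end_near. Qed.

(** Monotone convergence for [- f], frozen before time [a] so that it is monotone on the whole
    line. *)
Lemma antitone_bounded_cvg f df (a m : R) :
    (forall t, a <= t -> is_derive t 1 f (df t)) ->
    (forall t, a <= t -> df t <= 0) -> (forall t, a <= t -> m <= f t) ->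
  exists L : R, f t @[t --> +oo] --> L.
Proof.
move=> Hf Hd Hm; pose g t := - f (Num.max t a).
have ge_a (t : R) : a <= Num.max t a by rewrite le_max lexx orbT.
have ng : {homo g : x y / x <= y}.
  move=> x y xy; rewrite /g lerN2.
  have le : Num.max x a <= Num.max y a by rewrite ge_max ge_a andbT le_max xy.
  have [t /andP[t0 _]|c /andP[c0 _] E] := @MVT_is_derive f df _ _ le.
    by apply: Hf; exact: le_trans t0.
  have := Hd c (le_trans (ge_a _) c0); rewrite -subr_le0 E => d0.
  by rewrite mulr_le0_ge0 // subr_ge0.
have /(nondecreasing_cvgr ng) gc : has_ubound (range g).
  by exists (- m) => _ [t _ <-]; rewrite lerN2 Hm.
exists (- sup (range g)).
move: gc => /cvgN; apply: cvg_trans; apply: near_eq_cvg; near=> t.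
rewrite /g /= opprK max_l //; near: t; apply: nbhs_pinfty_ge; exact: num_real.
Unshelve. all: by end_near. Qed.

End RealAnalysis.

(* The algebra library has another [skew]. *)
Local Notation skew := Defs.skew.

(** * Vector algebra in dimension three *)

Lemma ord3_ind (P : 'I_3 -> Prop) : P 0 -> P 1 -> P 2 -> forall i, P i.
Proof.
move=> P0 P1 P2 [[|[|[|//]]] Hi].
- by rewrite (_ : Ordinal Hi = 0) //; exact: val_inj.
- by rewrite (_ : Ordinal Hi = 1) //; exact: val_inj.
- by rewrite (_ : Ordinal Hi = 2) //; exact: val_inj.
Qed.

Lemma sum_ord3 (V : nmodType) (F : 'I_3 -> V) : \sum_i F i = F 0 + F 1 + F 2.
Proof.
rewrite !big_ord_recl big_ord0 addr0 addrA.
by congr (F _ + F _ + F _); exact: val_inj.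
Qed.

Section VectorAlgebra.
Variable R : realType.
Implicit Types (a b c : 'cV[R]_3) (Q : 'M[R]_3).

Definition dot a b : R := (a^T *m b) 0 0.

Lemma dotE a b : dot a b = \sum_i a i 0 * b i 0.
Proof. by rewrite /dot mxE; apply: eq_bigr => i _; rewrite mxE. Qed.

Lemma dotC a b : dot a b = dot b a.
Proof. by rewrite !dotE; apply: eq_bigr => i _; rewrite mulrC. Qed.

Lemma dotDl a b c : dot (a + b) c = dot a c + dot b c.
Proof. by rewrite /dot linearD mulmxDl mxE. Qed.

Lemma dotDr a b c : dot a (b + c) = dot a b + dot a c.
Proof. by rewrite /dot mulmxDr mxE. Qed.

Lemma dotNl a b : dot (- a) b = - dot a b.
Proof. by rewrite /dot linearN mulNmx mxE. Qed.

Lemma dotNr a b : dot a (- b) = - dot a b.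
Proof. by rewrite /dot mulmxN mxE. Qed.

Lemma dotZl (k : R) a b : dot (k *: a) b = k * dot a b.
Proof. by rewrite /dot linearZ -scalemxAl mxE. Qed.

Lemma dotZr (k : R) a b : dot a (k *: b) = k * dot a b.
Proof. by rewrite /dot -scalemxAr mxE. Qed.

Lemma dot_sumr (I : Type) (r : seq I) (F : I -> 'cV[R]_3) a :
  dot a (\sum_(i <- r) F i) = \sum_(i <- r) dot a (F i).
Proof. by rewrite /dot mulmx_sumr summxE. Qed.

Lemma dot_mull Q a b : dot (Q *m a) b = dot a (Q^T *m b).
Proof. by rewrite /dot trmx_mul mulmxA. Qed.

Lemma dot_ge0 a : 0 <= dot a a.
Proof. by rewrite dotE sumr_ge0 // => i _; rewrite -expr2 sqr_ge0. Qed.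

Lemma sqr_coord_le_dot a i : a i 0 ^+ 2 <= dot a a.
Proof.
rewrite dotE (bigD1 i) //= expr2 lerDl sumr_ge0 // => j _.
by rewrite -expr2 sqr_ge0.
Qed.

Lemma dot_eq0 a : dot a a = 0 -> a = 0.
Proof.
move=> a0; apply/colP => i; rewrite [RHS]mxE; apply/eqP; rewrite -sqrf_eq0 eq_le.
by rewrite sqr_ge0 andbT -a0 sqr_coord_le_dot.
Qed.

Lemma l2norm_cV a : l2norm a ^+ 2 = dot a a.
Proof.
rewrite /l2norm sqr_sqrtr.
  by rewrite dotE; apply: eq_bigr => i _; rewrite big_ord1 expr2.
by do 2 (rewrite sumr_ge0 // => ? _); exact: sqr_ge0.
Qed.

Lemma crossE a b :
  (cross a b 0 0 = a 1 0 * b 2 0 - a 2 0 * b 1 0) *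
  (cross a b 1 0 = a 2 0 * b 0 0 - a 0 0 * b 2 0) *
  (cross a b 2 0 = a 0 0 * b 1 0 - a 1 0 * b 0 0).
Proof.
by do ?split; rewrite mxE; congr (a _ _ * b _ _ - a _ _ * b _ _); exact: val_inj.
Qed.

Lemma skewC a b : skew a *m b = - (skew b *m a).
Proof.
by rewrite !skewP; apply/colP; elim/ord3_ind; rewrite [RHS]mxE !crossE; ring.
Qed.

Lemma tr_skew a : (skew a)^T = - skew a.
Proof.
have skE i j : skew a i j = cross a (delta_mx j 0) i 0 by rewrite mxE.
apply/matrixP; do 2 elim/ord3_ind;
  by rewrite mxE [RHS]mxE !skE !crossE !mxE -!val_eqE /=; ring.
Qed.

Lemma skew_is_linear : linear (@skew R).
Proof.
move=> k a b; apply/matrixP => i j; rewrite !mxE; ring.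
Qed.
HB.instance Definition _ :=
  GRing.isLinear.Build R 'cV[R]_3 'M[R]_3 _ (@skew R) skew_is_linear.

Lemma dot_skew_self a b : dot a (skew b *m a) = 0.
Proof.
have := dotC a (skew b *m a).
by rewrite [in RHS]dot_mull tr_skew mulNmx dotNr; lra.
Qed.

Lemma dot_skew_left a b : dot a (skew a *m b) = 0.
Proof. by rewrite skewC dotNr dot_skew_self oppr0. Qed.

Lemma skew_eq0 a : skew a = 0 -> a = 0.
Proof.
move=> a0.
have sk0 i j : cross a (delta_mx j 0) i 0 = 0.
  by move/matrixP : a0 => /(_ i j); rewrite !mxE.
have := sk0 2 1; have := sk0 0 2; have := sk0 1 0.
rewrite !crossE !mxE -!val_eqE /= => h1 h2 h0.
by apply/colP; elim/ord3_ind; rewrite [RHS]mxE; lra.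
Qed.

(** The triple product expansion. When [a] and [b] have zero cross product it exhibits [a] as a
    multiple of a nonzero [b]. *)
Lemma skew_skew a b :
  skew b *m (skew a *m b) = dot b b *: a - dot a b *: b.
Proof.
rewrite !skewP; apply/colP; elim/ord3_ind;
  by rewrite ![in RHS]mxE !dotE !sum_ord3 !crossE; ring.
Qed.

Lemma det_mx22 (A : 'M[R]_2) : \det A = A 0 0 * A 1 1 - A 0 1 * A 1 0.
Proof.
rewrite (expand_det_row _ 0) !big_ord_recl big_ord0 /cofactor !det_mx11 !mxE /=.
rewrite (_ : lift 0 0 = 1); last exact: val_inj.
rewrite (_ : lift 1 0 = 0); last exact: val_inj.
by rewrite /bump /= expr0 expr1; ring.
Qed.

Lemma det_mx33 Q : \det Q =
  Q 0 0 * (Q 1 1 * Q 2 2 - Q 1 2 * Q 2 1) -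
  Q 0 1 * (Q 1 0 * Q 2 2 - Q 1 2 * Q 2 0) +
  Q 0 2 * (Q 1 0 * Q 2 1 - Q 1 1 * Q 2 0).
Proof.
have l00 : lift (0 : 'I_3) (0 : 'I_2) = 1 by exact: val_inj.
have l01 : lift (0 : 'I_3) (1 : 'I_2) = 2 by exact: val_inj.
have l10 : lift (1 : 'I_3) (0 : 'I_2) = 0 by exact: val_inj.
have l11 : lift (1 : 'I_3) (1 : 'I_2) = 2 by exact: val_inj.
have l20 : lift (2 : 'I_3) (0 : 'I_2) = 0 by exact: val_inj.
have l21 : lift (2 : 'I_3) (1 : 'I_2) = 1 by exact: val_inj.
rewrite (expand_det_row _ 0) sum_ord3 /cofactor !det_mx22 !mxE.
by rewrite l00 l01 l10 l11 l20 l21 /= !add0n expr0 expr1 sqrrN expr1n; ring.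
Qed.
End VectorAlgebra.

(** * Reduced force and torque, the inertia matrix, equilibria *)

Section Registration.
Variables (R : realType) (N : nat) (D : registration R N).
Hypothesis sigma_gt0 : forall i, 0 < sigma D i.
Hypothesis tgt_centered : tgt_center D = 0.
Hypothesis noncollinear : exists i j k : 'I_N,
  ~ collinear (src D i) (src D j) (src D k).
Local Notation M := (total_mass D).
Local Notation J := (inertia D).
Local Notation x := (src_rel D).
Local Notation y := (tgt D).

Lemma mass_gt0 i : 0 < mass D i.
Proof. by rewrite divr_gt0 // exprn_gt0. Qed.

Lemma springE i : spring D i = 2 * mass D i.
Proof. by rewrite /spring /mass mulrA mulr1. Qed.

Lemma total_mass_gt0 : 0 < M.
Proof.
have [i _] := noncollinear.
rewrite /total_mass (bigD1 i) //= ltr_pwDl ?mass_gt0 // sumr_ge0 // => j _.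
exact/ltW/mass_gt0.
Qed.

Lemma sum_src_rel : \sum_i mass D i *: x i = 0.
Proof.
rewrite /src_rel; under eq_bigr do rewrite scalerBr.
rewrite sumrB -scaler_suml /src_center scalerA mulfV ?scale1r ?subrr //.
by rewrite gt_eqF // total_mass_gt0.
Qed.

Lemma sum_tgt : \sum_i mass D i *: y i = 0.
Proof.
move/eqP : tgt_centered; rewrite scaler_eq0 invr_eq0 gt_eqF ?total_mass_gt0 //=.
by move/eqP.
Qed.

(** Both clouds have their weighted mean at the origin, so in the sum of the springs only the term
    in [st_pos s] survives. *)
Lemma forceE s :
  force D s = - (2 * M) *: st_pos s - (mu D * M) *: st_vel s.
Proof.
congr (_ - _); under eq_bigr do rewrite springE -scalerA.
rewrite -scaler_sumr; under eq_bigr do rewrite !scalerBr scalemxAr.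
rewrite !sumrB sum_tgt -mulmx_sumr sum_src_rel mulmx0 subr0 sub0r.
by rewrite -scaler_suml scalerN scalerA scaleNr.
Qed.

(** The elastic torque about the center of mass: minus the gradient, in body-frame angular velocity,
    of the spring energy as a function of the rotation. *)
Definition restoring_torque (Q : 'M[R]_3) : 'cV[R]_3 :=
  \sum_i spring D i *: (skew (x i) *m Q^T *m y i).

(** The contribution of the position is linear in the weighted sum of the [x i], which is zero. The
    friction term becomes [J *m w] because [[x]_x [w]_x x = - [x]_x [x]_x w]. *)
Lemma torqueE s : torque D s =
  restoring_torque (st_rot s) - mu D *: (J *m st_angvel s).
Proof.
rewrite /torque sumrB; congr (_ - _).
  under eq_bigr do rewrite mulmxBr scalerBr springE.
  rewrite sumrB; under eq_bigr do rewrite -springE.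
  rewrite -[RHS]subr0; congr (_ - _).
  transitivity ((2 *: skew (\sum_i mass D i *: x i)) *m
     (st_rot s)^T *m st_pos s).
    rewrite linear_sum scaler_sumr !mulmx_suml; apply: eq_bigr => i _.
    by rewrite linearZ scalerA !scalemxAl.
  by rewrite sum_src_rel linear0 scaler0 !mul0mx.
rewrite /inertia mulNmx scalerN mulmx_suml scaler_sumr -sumrN.
apply: eq_bigr => i _.
by rewrite -[in RHS]scalemxAl scalerA -!mulmxA (skewC (st_angvel s)) mulmxN scalerN.
Qed.

Lemma tr_inertia : J^T = J.
Proof.
rewrite /inertia linearN linear_sum; congr (- _); apply: eq_bigr => i _ /=.
by rewrite linearZ /= trmx_mul tr_skew mulmxN mulNmx opprK.
Qed.

(** Each [skew (x i)] is antisymmetric, so minus its square is a Gram matrix. This is twice the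
    rotational kinetic energy. *)
Lemma inertia_form w : dot w (J *m w) =
  \sum_i mass D i * dot (skew (x i) *m w) (skew (x i) *m w).
Proof.
rewrite /inertia mulNmx mulmx_suml dotNr dot_sumr -sumrN; apply: eq_bigr => i _.
rewrite -scalemxAl dotZr -mulrN; congr (_ * _).
by rewrite [RHS]dot_mull tr_skew mulNmx dotNr mulmxA.
Qed.

Lemma inertia_form_ge0 w : 0 <= dot w (J *m w).
Proof.
rewrite inertia_form sumr_ge0 // => i _.
by rewrite mulr_ge0 ?dot_ge0 // ltW // mass_gt0.
Qed.

(** A kernel vector [w] annihilates the quadratic form, hence is parallel to every [x i]. If it is
    nonzero, all source points lie on the line through the center of mass directed by [w]. *)
Lemma inertia_unit : J \in unitmx.
Proof.
rewrite -row_free_unit -kermx_eq0; apply/eqP/row_matrixP => l.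
rewrite row0; set r := row l _.
have : r *m J = 0 by apply/sub_kermxP; rewrite row_sub.
move/(congr1 trmx); rewrite trmx_mul tr_inertia trmx0 => Jr.
suff : r^T = 0 by move/(congr1 trmx); rewrite trmxK trmx0.
have := inertia_form r^T; rewrite Jr /dot mulmx0 mxE => /esym/eqP.
rewrite psumr_eq0; last first.
  by move=> i _; rewrite mulr_ge0 ?dot_ge0 // ltW // mass_gt0.
move=> /allP H; set w := r^T in H *.
have Hx i : skew (x i) *m w = 0.
  apply/dot_eq0/eqP; have := H i; rewrite mem_index_enum => /(_ isT).
  by rewrite mulf_eq0 gt_eqF ?mass_gt0.
apply/eqP/negPn/negP => w0.
have [i [j [k]]] := noncollinear; apply.
exists (src_center D), w.
suff K m : exists r, src D m = src_center D + r *: w.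
  by move=> z; rewrite !inE => /or3P[]/eqP ->.
exists (dot (x m) w / dot w w).
have := skew_skew (x m) w; rewrite Hx mulmx0 => /esym/eqP; rewrite subr_eq0.
move=> /eqP E; rewrite mulrC -scalerA -E scalerA mulVf ?scale1r.
  by rewrite /src_rel addrC subrK.
by apply: contra w0 => /eqP/dot_eq0 ->.
Qed.

Lemma vector_fieldE s : vector_field D s =
  (st_vel s, st_rot s *m skew (st_angvel s),
   - 2 *: st_pos s - mu D *: st_vel s,
   invmx J *m (restoring_torque (st_rot s) - mu D *: (J *m st_angvel s)
     - skew (st_angvel s) *m (J *m st_angvel s))).
Proof.
rewrite /vector_field torqueE skewP forceE scalerBr !scalerA.
have M0 : M != 0 by rewrite gt_eqF // total_mass_gt0.
by congr (_, _, _ *: _ - _ *: _, _); field.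
Qed.

Lemma potential_energyE s (t := st_pos s - st_rot s *m src_center D) :
  potential_energy D s = \sum_i 1 / sigma D i ^+ 2
     * l2norm (tgt D i - st_rot s *m src D i - t) ^+ 2.
Proof.
rewrite /potential_energy; apply: eq_bigr => i _.
congr (_ * _ ^+ 2); last congr l2norm.
  by rewrite springE mulrAC mulfV ?pnatr_eq0 //; exact: mul1r.
by rewrite /src_rel /t mulmxBr; apply/colP => l; rewrite !mxE; ring.
Qed.

(** The components vanish in turn: [p' = 0] gives [v = 0], then [v' = 0] gives [p = 0]; cancelling
    the orthogonal matrix in [Q' = 0] gives [w = 0], and [w' = 0] reduces to the restoring
    torque. *)
Lemma equilibriaP s : equilibria D s <->
  state_space s /\ [/\ st_pos s = 0, st_vel s = 0, st_angvel s = 0 &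
    restoring_torque (st_rot s) = 0].
Proof.
rewrite /equilibria /= vector_fieldE; split=> -[Hs].
  case=> v0 Qw; rewrite v0 scaler0 subr0 => /eqP p0 T0; split=> //.
  move: p0; rewrite scaler_eq0 oppr_eq0 pnatr_eq0 /= => /eqP p0.
  have w0 : st_angvel s = 0.
    by apply: skew_eq0; rewrite -[LHS]mul1mx -Hs.1 -mulmxA Qw mulmx0.
  split=> //; move: T0; rewrite w0 !mulmx0 scaler0 !subr0.
  by move/(congr1 (mulmx J)); rewrite mulmxA mulmxV ?inertia_unit // mul1mx mulmx0.
move=> [p0 v0 w0 T0]; split=> //.
by rewrite p0 v0 w0 T0 linear0 !mulmx0 !scaler0 !subr0 mulmx0.
Qed.

End Registration.

(** * Derivatives of vector-valued and matrix-valued curves *)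

Section Curves.
Variable R : realType.

Lemma is_deriveP (V W : normedModType R) (f : V -> W) (a v : V) (d : W) :
  is_derive a v f d <->
  h^-1 *: (f (h *: v + a) - f a) @[h --> (0 : R)^'] --> d.
Proof.
split=> [[fd <-]|fd]; first exact: fd.
by split; [apply/cvg_ex; exists d|exact: cvg_lim].
Qed.

Lemma is_derive_pairP (V W1 W2 : normedModType R) (f : V -> W1) (g : V -> W2)
    (a v : V) (d : W1 * W2) :
  is_derive a v (fun t => (f t, g t)) d <->
  is_derive a v f d.1 /\ is_derive a v g d.2.
Proof.
rewrite !is_deriveP; split=> [H|[Hf Hg]].
  split; [have := cvg_comp _ fst H | have := cvg_comp _ snd H]; apply.
    exact: cvg_fst.
  exact: cvg_snd.
by case: d Hf Hg => d1 d2 /= Hf Hg; exact: cvg_pair Hf Hg.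
Qed.

Lemma is_derive_mxP (V : normedModType R) m n (A : V -> 'M[R]_(m, n)) a v d :
  is_derive a v A d <->
  forall i j, is_derive a v (fun t => A t i j) (d i j).
Proof.
split=> [[/[dup] Ad /derivable_mxP Adij <-] i j|H].
  by split; [exact: Adij|rewrite derive_mx // mxE].
have Ad : derivable A a v by apply/derivable_mxP => i j; have [] := H i j.
split=> //; rewrite derive_mx //; apply/matrixP => i j; rewrite mxE.
by have [] := H i j.
Qed.

Lemma is_derive_bigsum (V W : normedModType R) n (f : 'I_n -> V -> W) a v d :
  (forall i, is_derive a v (f i) (d i)) ->
  is_derive a v (fun t => \sum_(i < n) f i t) (\sum_(i < n) d i).
Proof.
move=> H; have := is_derive_sum H; congr is_derive.
by apply/funext => t; rewrite fct_sumE.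
Qed.

Lemma is_derive_mulmx (V : normedModType R) m n p
    (A : V -> 'M[R]_(m, n)) (B : V -> 'M[R]_(n, p)) a v dA dB :
  is_derive a v A dA -> is_derive a v B dB ->
  is_derive a v (fun t => A t *m B t) (dA *m B a + A a *m dB).
Proof.
move=> /is_derive_mxP HA /is_derive_mxP HB; apply/is_derive_mxP => i j.
under [X in is_derive _ _ X _]funext do rewrite mxE.
rewrite !mxE -big_split; apply: is_derive_bigsum => k.
apply: is_derive_eq (is_deriveM (HA i k) (HB k j)) _.
by rewrite addrC; congr (_ + _); exact: mulrC.
Qed.

Lemma is_derive_trmx (V : normedModType R) m n (A : V -> 'M[R]_(m, n)) a v d :
  is_derive a v A d -> is_derive a v (fun t => (A t)^T) d^T.
Proof.
move=> /is_derive_mxP H; apply/is_derive_mxP => i j.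
by under [X in is_derive _ _ X _]funext do rewrite mxE; rewrite mxE.
Qed.

Lemma is_derive_dot (V : normedModType R) (f g : V -> 'cV[R]_3) a v df dg :
  is_derive a v f df -> is_derive a v g dg ->
  is_derive a v (fun t => dot (f t) (g t)) (dot df (g a) + dot (f a) dg).
Proof.
move=> /is_derive_trmx /is_derive_mulmx H /H /is_derive_mxP /(_ 0 0) H'.
by apply: is_derive_eq H' _; rewrite mxE.
Qed.

Lemma is_derive0_const (f : R -> R) (t : R) :
  (forall s : R, 0 <= s -> is_derive s 1 f 0) -> 0 <= t -> f t = f 0.
Proof.
move=> H t0; have [|c _ /eqP] := @MVT_is_derive R f (cst 0) 0 t t0.
  by move=> x /andP[x0 _]; exact: H.
by rewrite mul0r subr_eq0 => /eqP.
Qed.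

End Curves.

(** * The state as a family of 18 real coordinates *)

Section Coordinates.
Variable R : realType.

(** A finite index type turns the state into a real function, the form that [picard] and the
    Lipschitz calculus work with. *)
Definition coord_index : Type := ('I_3 + 'I_3 * 'I_3 + 'I_3 + 'I_3)%type.

Definition st_coord (s : state R) (k : coord_index) : R :=
  match k with
  | inl (inl (inl i)) => st_pos s i 0
  | inl (inl (inr ij)) => st_rot s ij.1 ij.2
  | inl (inr i) => st_vel s i 0
  | inr i => st_angvel s i 0
  end.

Definition of_coord (a : coord_index -> R) : state R :=
  (\col_i a (inl (inl (inl i))), \matrix_(i, j) a (inl (inl (inr (i, j)))),
   \col_i a (inl (inr i)), \col_i a (inr i)).

Lemma of_coordK a : st_coord (of_coord a) = a.
Proof. by apply/funext => -[[[i|[i j]]|i]|i]; rewrite /= mxE. Qed.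

Lemma st_coordK s : of_coord (st_coord s) = s.
Proof.
case: s => [[[p Q] v] w]; congr (_, _, _, _).
- by apply/colP => i; rewrite mxE.
- by apply/matrixP => i j; rewrite mxE.
- by apply/colP => i; rewrite mxE.
- by apply/colP => i; rewrite mxE.
Qed.

Lemma is_derive_stateP (s : R -> state R) (t : R) d :
  is_derive t 1 s d <->
  [/\ is_derive t 1 (fun u => st_pos (s u)) (st_pos d),
      is_derive t 1 (fun u => st_rot (s u)) (st_rot d),
      is_derive t 1 (fun u => st_vel (s u)) (st_vel d) &
      is_derive t 1 (fun u => st_angvel (s u)) (st_angvel d)].
Proof.
have -> : s = (fun t => ((st_pos (s t), st_rot (s t), st_vel (s t)),
    st_angvel (s t))).
  by apply/funext => u /=; case: (s u) => [[[]]].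
case: d => [[[dp dQ] dv] dw]; split.
  by move=> /is_derive_pairP[/is_derive_pairP[/is_derive_pairP[]]].
move=> [? ? ? ?]; do 3 (apply/is_derive_pairP; split => //).
Qed.

Lemma is_derive_coordP (s : R -> state R) (t : R) d :
  is_derive t 1 s d <->
  forall k, is_derive t 1 (fun u => st_coord (s u) k) (st_coord d k).
Proof.
rewrite is_derive_stateP; split.
  move=> [/is_derive_mxP Hp /is_derive_mxP HQ /is_derive_mxP Hv /is_derive_mxP Hw].
  by move=> [[[i|[i j]]|i]|i]; [exact: Hp|exact: HQ|exact: Hv|exact: Hw].
move=> H; split; apply/is_derive_mxP => i j; rewrite ?ord1.
- exact: (H (inl (inl (inl i)))).
- exact: (H (inl (inl (inr (i, j))))).
- exact: (H (inl (inr i))).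
- exact: (H (inr i)).
Qed.

End Coordinates.

(** * A calculus of bounded Lipschitz functions *)

Section BoundedLipschitz.
Variables (R : realType) (I : Type).
Implicit Types f g : (I -> R) -> R.

(* Lipschitz with respect to the sup norm on [I -> R]. *)
Definition bounded_lip f := exists K : R, [/\ 0 <= K, forall a, `|f a| <= K &
  forall a b (r : R), 0 <= r -> (forall k, `|a k - b k| <= r) ->
    `|f a - f b| <= K * r].

Lemma bounded_lip_cst c : bounded_lip (cst c).
Proof.
by exists `|c|; split => // a b r r0 _; rewrite subrr normr0 mulr_ge0.
Qed.

Lemma bounded_lipD f g :
  bounded_lip f -> bounded_lip g -> bounded_lip (fun a => f a + g a).
Proof.
move=> [K [K0 fK fL]] [H [H0 gH gL]]; exists (K + H); split.
- exact: addr_ge0.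
- by move=> a; rewrite (le_trans (ler_normD _ _)) // lerD.
- move=> a b r r0 ab; rewrite opprD addrACA mulrDl.
  by rewrite (le_trans (ler_normD _ _)) // lerD // ?fL ?gL.
Qed.

(** Here the bound is what matters: a product of Lipschitz functions is Lipschitz when both factors
    are bounded. *)
Lemma bounded_lipM f g :
  bounded_lip f -> bounded_lip g -> bounded_lip (fun a => f a * g a).
Proof.
move=> [K [K0 fK fL]] [H [H0 gH gL]]; exists (K * H + K * H); split.
- by rewrite addr_ge0 // mulr_ge0.
- move=> a; rewrite normrM (@le_trans _ _ (K * H)) ?ler_pM // lerDl.
  exact: mulr_ge0.
- move=> a b r r0 ab.
  have -> : f a * g a - f b * g b = f a * (g a - g b) + (f a - f b) * g b by ring.
  rewrite (le_trans (ler_normD _ _)) // !normrM.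
  have -> : (K * H + K * H) * r = K * (H * r) + (K * r) * H by ring.
  by rewrite lerD // ler_pM // ?fL ?gL.
Qed.

Lemma bounded_lipN f : bounded_lip f -> bounded_lip (fun a => - f a).
Proof.
move=> [K [K0 fK fL]]; exists K; split=> //.
  by move=> a; rewrite normrN.
by move=> a b r r0 ab; rewrite -opprD normrN fL.
Qed.

Lemma bounded_lip_sum (T : Type) (r : seq T) (F : T -> (I -> R) -> R) :
  (forall i, bounded_lip (F i)) -> bounded_lip (fun a => \sum_(i <- r) F i a).
Proof.
move=> H; elim: r => [|i r IH].
  by under [X in bounded_lip X]funext do rewrite big_nil; exact: bounded_lip_cst.
under [X in bounded_lip X]funext do rewrite big_cons.
exact: bounded_lipD.
Qed.

Lemma bounded_lip_prod (T : Type) (r : seq T) (F : T -> (I -> R) -> R) :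
  (forall i, bounded_lip (F i)) -> bounded_lip (fun a => \prod_(i <- r) F i a).
Proof.
move=> H; elim: r => [|i r IH].
  by under [X in bounded_lip X]funext do rewrite big_nil; exact: bounded_lip_cst.
under [X in bounded_lip X]funext do rewrite big_cons.
exact: bounded_lipM.
Qed.

Lemma bounded_lip_coord (phi : R -> R) C k : (forall x, `|phi x| <= C) ->
    (forall x y, `|phi x - phi y| <= `|x - y|) ->
  bounded_lip (fun a => phi (a k)).
Proof.
move=> bd lip; have C0 : 0 <= C by exact: le_trans (bd 0).
(* One constant serves as bound, being at least [C], and as Lipschitz constant, being at least 1. *)
exists (C + 1); split; first exact: addr_ge0.
  by move=> a; rewrite (le_trans (bd _)) // lerDl.
move=> a b r r0 ab; rewrite (le_trans (lip _ _)) // (le_trans (ab k)) //.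
by rewrite ler_peMl // lerDr.
Qed.

Definition mx_bounded_lip m n (A : (I -> R) -> 'M[R]_(m, n)) :=
  forall i j, bounded_lip (fun a => A a i j).

Lemma mx_bounded_lip_cst m n (A : 'M[R]_(m, n)) : mx_bounded_lip (cst A).
Proof. by move=> i j; exact: bounded_lip_cst. Qed.

Lemma mx_bounded_lipD m n (A B : (I -> R) -> 'M[R]_(m, n)) :
  mx_bounded_lip A -> mx_bounded_lip B -> mx_bounded_lip (fun a => A a + B a).
Proof.
move=> HA HB i j; under [X in bounded_lip X]funext do rewrite mxE.
exact: bounded_lipD.
Qed.

Lemma mx_bounded_lipN m n (A : (I -> R) -> 'M[R]_(m, n)) :
  mx_bounded_lip A -> mx_bounded_lip (fun a => - A a).
Proof.
move=> HA i j; under [X in bounded_lip X]funext do rewrite mxE.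
exact: bounded_lipN.
Qed.

Lemma mx_bounded_lipZ m n (A : (I -> R) -> 'M[R]_(m, n)) c :
  mx_bounded_lip A -> mx_bounded_lip (fun a => c *: A a).
Proof.
move=> HA i j; under [X in bounded_lip X]funext do rewrite mxE.
by apply: bounded_lipM => //; exact: bounded_lip_cst.
Qed.

Lemma mx_bounded_lipM m n p (A : (I -> R) -> 'M[R]_(m, n))
    (B : (I -> R) -> 'M[R]_(n, p)) :
  mx_bounded_lip A -> mx_bounded_lip B -> mx_bounded_lip (fun a => A a *m B a).
Proof.
move=> HA HB i j; under [X in bounded_lip X]funext do rewrite mxE.
by apply: bounded_lip_sum => k; exact: bounded_lipM.
Qed.

Lemma mx_bounded_lip_tr m n (A : (I -> R) -> 'M[R]_(m, n)) :
  mx_bounded_lip A -> mx_bounded_lip (fun a => (A a)^T).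
Proof. by move=> HA i j; under [X in bounded_lip X]funext do rewrite mxE. Qed.

Lemma mx_bounded_lip_sum m n (T : Type) (r : seq T)
    (A : T -> (I -> R) -> 'M[R]_(m, n)) :
  (forall t, mx_bounded_lip (A t)) ->
  mx_bounded_lip (fun a => \sum_(t <- r) A t a).
Proof.
move=> HA i j; under [X in bounded_lip X]funext do rewrite summxE.
by apply: bounded_lip_sum => t; exact: HA.
Qed.

Lemma mx_bounded_lip_skew (A : (I -> R) -> 'cV[R]_3) :
  mx_bounded_lip A -> mx_bounded_lip (fun a => skew (A a)).
Proof.
move=> HA i j; under [X in bounded_lip X]funext do rewrite !mxE.
by apply: bounded_lipD; [|apply: bounded_lipN]; apply: bounded_lipM => //;
  exact: bounded_lip_cst.
Qed.

End BoundedLipschitz.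

(** * Dissipation of energy and invariance of the rotation constraint *)

Section Energy.
Variables (R : realType) (N : nat) (D : registration R N).
Hypothesis sigma_gt0 : forall i, 0 < sigma D i.
Hypothesis mu_gt0 : 0 < mu D.
Hypothesis tgt_centered : tgt_center D = 0.
Hypothesis noncollinear : exists i j k : 'I_N,
  ~ collinear (src D i) (src D j) (src D k).
Local Notation M := (total_mass D).
Local Notation J := (inertia D).
Local Notation x := (src_rel D).
Local Notation y := (tgt D).

Definition residual (Q : 'M[R]_3) i : 'cV[R]_3 := y i - Q *m x i.

(* On the state space this is [total_energy D], with the center of mass
   separated from the rotation. *)
Definition energy (s : state R) : R :=
  M / 2 * dot (st_vel s) (st_vel s) + M * dot (st_pos s) (st_pos s)
  + 2^-1 * dot (st_angvel s) (J *m st_angvel s)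
  + \sum_i mass D i * dot (residual (st_rot s) i) (residual (st_rot s) i).

Definition dissipation (s : state R) : R :=
  mu D * (M * dot (st_vel s) (st_vel s)
          + dot (st_angvel s) (J *m st_angvel s)).

Lemma dissipation_ge0 s : 0 <= dissipation s.
Proof.
apply: mulr_ge0; first exact: ltW.
apply: addr_ge0; last exact: inertia_form_ge0.
by apply: mulr_ge0; [exact/ltW/total_mass_gt0|exact: dot_ge0].
Qed.

(** The elastic forces exchange kinetic and potential energy, both in translation and in rotation,
    and the gyroscopic term does no work; only friction remains. The factor [c] accommodates the
    cut-off field. *)
Lemma is_derive_energy (s : R -> state R) (t c : R) : state_space (s t) ->
    is_derive t 1 s (c *: vector_field D (s t)) ->
  is_derive t 1 (fun u => energy (s u)) (- (c * dissipation (s t))).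
Proof.
move=> [QtQ _]; rewrite vector_fieldE // => /is_derive_stateP[].
set p := st_pos (s t); set Q := st_rot (s t); set v := st_vel (s t).
set w := st_angvel (s t); set tau := restoring_torque D Q => Hp HQ Hv Hw.
have {}Hp : is_derive t 1 (fun u => st_pos (s u)) (c *: v) := Hp.
have {}HQ : is_derive t 1 (fun u => st_rot (s u)) (c *: (Q *m skew w)) := HQ.
have {}Hv : is_derive t 1 (fun u => st_vel (s u))
  (c *: (- 2 *: p - mu D *: v)) := Hv.
have {}Hw : is_derive t 1 (fun u => st_angvel (s u))
  (c *: (invmx J *m (tau - mu D *: (J *m w) - skew w *m (J *m w)))) := Hw.
have Hvv := is_derive_dot Hv Hv.
have Hpp := is_derive_dot Hp Hp.
have Hww := is_derive_dot Hw (is_derive_mulmx (is_derive_cst J t 1) Hw).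
have Hres i : is_derive t 1 (fun u => residual (st_rot (s u)) i)
    (- (c *: (Q *m skew w) *m x i)).
  have H1 := is_derive_mulmx HQ (is_derive_cst (x i) t 1).
  apply: is_derive_eq (is_deriveB (is_derive_cst (y i) t 1) H1) _.
  by rewrite mulmx0 addr0 sub0r.
have HU := is_derive_bigsum (fun i =>
  is_deriveZ (mass D i) (is_derive_dot (Hres i) (Hres i))).
have Hsum := is_deriveD (is_deriveD (is_deriveD (is_deriveZ (M / 2) Hvv)
  (is_deriveZ M Hpp)) (is_deriveZ 2^-1 Hww)) HU.
apply: is_derive_eq Hsum _; rewrite -/p -/Q -/v -/w.
(* By orthogonality of [Q], the part of the residual in [Q *m x i] contributes [x i] against [[w]_x
   x i], which is zero; the part in [y i] assembles into the restoring torque. *)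
have -> : \sum_(i < N) mass D i *:
      (dot (- (c *: (Q *m skew w) *m x i)) (residual Q i) +
       dot (residual Q i) (- (c *: (Q *m skew w) *m x i))) = - (c * dot w tau).
  rewrite /tau /restoring_torque dot_sumr mulr_sumr -sumrN; apply: eq_bigr => i _.
  rewrite (dotC _ (residual Q i)) dotNr -scalemxAl dotZr dotDl dotNl.
  rewrite -!mulmxA (dot_mull Q (x i)) (mulmxA Q^T) QtQ mul1mx dot_skew_self.
  rewrite (skewC w) mulmxN dotNr dotC !dot_mull tr_skew mulNmx dotNr.
  rewrite dotZr springE mulmxA /GRing.scale /=; ring.
rewrite /cst mul0mx add0r.
set X := tau - _ - _.
have -> : J *m (c *: (invmx J *m X)) = c *: X.
  by rewrite -scalemxAr mulmxA mulmxV ?inertia_unit ?mul1mx.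
have -> : dot (c *: (invmx J *m X)) (J *m w) = c * dot w X.
  rewrite dotZl dot_mull trmx_inv tr_inertia mulmxA mulVmx ?inertia_unit //.
  by rewrite mul1mx dotC.
rewrite /X !(dotZl, dotZr, dotDl, dotDr, dotNl, dotNr) dot_skew_left.
by rewrite (dotC p v) /dissipation -/v -/w /GRing.scale /=; field.
Qed.

(** With [Q' = c Q W] and [W] antisymmetric, the two terms of the derivative of [Q Q^T] cancel
    identically, whereas that of [Q^T Q] is a commutator; hence the product in this order. The
    determinant is constant because [W] has zero trace. *)
Lemma state_space_invariant (s : R -> state R) (c : R -> R) :
    state_space (s 0) ->
    (forall t : R, 0 <= t -> is_derive t 1 s (c t *: vector_field D (s t))) ->
  forall t : R, 0 <= t -> state_space (s t).
Proof.
move=> [QtQ0 det0] Hs t t0.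
pose Q t := st_rot (s t); pose W t := skew (st_angvel (s t)).
have HQ (r : R) : 0 <= r -> is_derive r 1 Q (c r *: (Q r *m W r)).
  by move=> /Hs; rewrite vector_fieldE // => /is_derive_stateP[].
have QQt : Q t *m (Q t)^T = 1%:M.
  apply/matrixP => i j.
  rewrite -(mulmx1C QtQ0).
  apply: (@is_derive0_const _ (fun t => (Q t *m (Q t)^T) i j)) => // r r0.
  have /is_derive_mxP/(_ i j) H :=
    is_derive_mulmx (HQ r r0) (is_derive_trmx (HQ r r0)).
  apply: is_derive_eq H _.
  rewrite linearZ /= trmx_mul tr_skew mulNmx.
  by rewrite scalerN mulmxN -scalemxAl -scalemxAr mulmxA subrr mxE.
split; first exact: mulmx1C.
rewrite -det0; apply: (@is_derive0_const _ (fun t => \det (Q t))) => // r r0.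
have /is_derive_mxP Hij := HQ r r0.
have Wa i j : W r i j = - W r j i.
  by have /matrixP/(_ j i) := tr_skew (st_angvel (s r)); rewrite !mxE.
have W0 i : W r i i = 0 by have := Wa i i; lra.
under [X in is_derive _ _ X _]funext do rewrite det_mx33.
apply: is_derive_eq; rewrite /GRing.scale /= !mxE !sum_ord3 !W0.
rewrite (Wa 1 0) (Wa 2 0) (Wa 2 1); ring.
Qed.

End Energy.

(** * Bounds on the coordinates in terms of the energy *)

Section Coercivity.
Variables (R : realType) (N : nat) (D : registration R N).
Hypothesis sigma_gt0 : forall i, 0 < sigma D i.
Hypothesis noncollinear : exists i j k : 'I_N,
  ~ collinear (src D i) (src D j) (src D k).
Local Notation M := (total_mass D).
Local Notation J := (inertia D).

Lemma energy_ge0 s : 0 <= energy D s.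
Proof.
have M0 := ltW (total_mass_gt0 sigma_gt0 noncollinear).
rewrite /energy !addr_ge0 ?mulr_ge0 ?dot_ge0 ?invr_ge0 ?inertia_form_ge0 //.
by apply: sumr_ge0 => i _; rewrite mulr_ge0 ?dot_ge0 // ltW // mass_gt0.
Qed.

Lemma energy_ge s :
  [/\ M / 2 * dot (st_vel s) (st_vel s) <= energy D s,
      M * dot (st_pos s) (st_pos s) <= energy D s &
      2^-1 * dot (st_angvel s) (J *m st_angvel s) <= energy D s].
Proof.
have M0 := ltW (total_mass_gt0 sigma_gt0 noncollinear).
have h1 : 0 <= M / 2 * dot (st_vel s) (st_vel s).
  by rewrite mulr_ge0 ?dot_ge0 // divr_ge0.
have h2 : 0 <= M * dot (st_pos s) (st_pos s) by rewrite mulr_ge0 ?dot_ge0.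
have h3 : 0 <= 2^-1 * dot (st_angvel s) (J *m st_angvel s).
  by rewrite mulr_ge0 ?inertia_form_ge0 ?invr_ge0.
have h4 : 0 <= \sum_i mass D i *
    dot (residual D (st_rot s) i) (residual D (st_rot s) i).
  by apply: sumr_ge0 => i _; rewrite mulr_ge0 ?dot_ge0 // ltW // mass_gt0.
rewrite /energy; split; lra.
Qed.

(* Expand [0 <= u . J u] at [u = e a - w] and [u = e a + w], where
   [J a] is the k-th basis vector. *)
Lemma angvel_coord_le (k : 'I_3) : exists2 C : R, 0 <= C &
  forall (w : 'cV[R]_3) (e : R),
  2 * e * `|w k 0| <= e ^+ 2 * C + dot w (J *m w).
Proof.
pose a : 'cV[R]_3 := invmx J *m delta_mx k 0; exists (dot a (J *m a)).
  exact: inertia_form_ge0.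
move=> w e.
have Ja : J *m a = delta_mx k 0 by rewrite mulmxA mulmxV ?inertia_unit ?mul1mx.
have wa : dot w (J *m a) = w k 0.
  rewrite Ja dotC dotE (bigD1 k) //= big1; first by rewrite mxE !eqxx mul1r addr0.
  by move=> i /negPf ik; rewrite mxE ik mul0r.
have aw : dot a (J *m w) = w k 0 by rewrite dotC dot_mull tr_inertia wa.
have H (d : R) : d ^+ 2 = 1 ->
    2 * d * e * w k 0 <= e ^+ 2 * dot a (J *m a) + dot w (J *m w).
  move=> d2; have := inertia_form_ge0 sigma_gt0 (d * e *: a - w).
  rewrite mulmxBr -scalemxAr !(dotDl, dotDr, dotNl, dotNr, dotZl, dotZr) aw wa.
  have : d ^+ 2 * (e ^+ 2 * dot a (J *m a)) = e ^+ 2 * dot a (J *m a).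
    by rewrite d2 mul1r.
  lra.
have := H 1 (expr1n _ _); have := H (-1) (etrans (sqrrN _) (expr1n _ _)).
by case: (ger0P (w k 0)) => _ ? ?; lra.
Qed.

Lemma SO3_coord_le (Q : 'M[R]_3) i j : SO3 Q -> `|Q i j| <= 1.
Proof.
move=> [QtQ _]; rewrite -ler_sqr ?nnegrE // expr1n real_normK ?num_real //.
have <- : \sum_k Q k j ^+ 2 = 1.
  have /matrixP/(_ j j) := QtQ; rewrite !mxE eqxx => QtQj.
  by rewrite -[RHS]QtQj; apply: eq_bigr => k _; rewrite mxE.
by rewrite (bigD1 i) //= lerDl; apply: sumr_ge0 => k _; exact: sqr_ge0.
Qed.

(** Orthogonality bounds the rotation; each other block is controlled by its own term of the energy,
    the angular velocity through [angvel_coord_le] at [e = 1]. *)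
Lemma coord_bounded h : exists B : R, forall s, state_space s -> energy D s <= h ->
  forall k, `|st_coord s k| <= B.
Proof.
have M0 := total_mass_gt0 sigma_gt0 noncollinear.
suff H k : exists B : R, forall s, state_space s -> energy D s <= h ->
    `|st_coord s k| <= B.
  have [B HB] := choice H; exists (\sum_k `|B k|) => s sS sh k.
  apply: (le_trans (HB _ _ sS sh)); rewrite (bigD1 k) //=.
  by rewrite (le_trans (ler_norm _)) // lerDl sumr_ge0.
have sqr_le (r C : R) : r ^+ 2 <= C -> `|r| <= 1 + C.
  move=> H; rewrite ler_norml; have := sqr_ge0 (r - 1); have := sqr_ge0 (r + 1).
  by move=> ? ?; apply/andP; split; nra.
case: k => [[[i|[i j]]|i]|i] /=.
- exists (1 + h / M) => s _ sh; apply: sqr_le.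
  apply: le_trans (sqr_coord_le_dot _ _) _.
  by rewrite ler_pdivlMr // mulrC; have [_ + _] := energy_ge s => /le_trans; apply.
- by exists 1 => s /(SO3_coord_le i j).
- exists (1 + 2 * h / M) => s _ sh; apply: sqr_le.
  apply: le_trans (sqr_coord_le_dot _ _) _.
  by rewrite ler_pdivlMr //; have [+ _ _] := energy_ge s => H; nra.
- have [C C0 HC] := angvel_coord_le i; exists (C + 2 * h) => s _ sh.
  have := HC (st_angvel s) 1; have [_ _ H] := energy_ge s.
  have := normr_ge0 (st_angvel s i 0); rewrite expr1n; lra.
Qed.

(** * Truncation of the state to a box *)

Definition clamp (B r : R) : R := Num.max (- B) (Num.min r B).

Lemma clampK B r : `|r| <= B -> clamp B r = r.
Proof. by rewrite /clamp ler_norml => /andP[? ?]; rewrite min_l // max_r. Qed.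

Lemma clamp_le B r : `|clamp B r| <= `|B|.
Proof.
have := ler_norm B; have := ler_norm (- B); rewrite normrN => NB_le B_le.
by rewrite /clamp ler_norml le_max ge_max ge_min NB_le B_le lerN2 B_le orbT.
Qed.

Lemma clamp_lip B r r' : `|clamp B r - clamp B r'| <= `|r - r'|.
Proof.
have := ler_norm (r - r'); have := ler_norm (r' - r); rewrite distrC => ? ?.
rewrite /clamp ler_norml; case: (leP r B) => ?; case: (leP r' B) => ?;
  by do ?case: (leP (- B) _) => ?; apply/andP; split; lra.
Qed.

(** Precomposition with this projection makes polynomial functions of the state bounded and
    Lipschitz, and leaves them unchanged on the box. *)
Definition truncate B (a : coord_index -> R) : state R :=
  of_coord (fun k => clamp B (a k)).

Lemma truncateK B (s : state R) :
  (forall k, `|st_coord s k| <= B) -> truncate B (st_coord s) = s.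
Proof.
move=> H; rewrite -[RHS]st_coordK; congr of_coord.
by apply/funext => k; rewrite clampK.
Qed.

Lemma truncate_bounded_lip B :
  [/\ mx_bounded_lip (fun a => st_pos (truncate B a)),
      mx_bounded_lip (fun a => st_rot (truncate B a)),
      mx_bounded_lip (fun a => st_vel (truncate B a)) &
      mx_bounded_lip (fun a => st_angvel (truncate B a))].
Proof.
by split=> i j; under [X in bounded_lip X]funext do rewrite mxE;
  apply: bounded_lip_coord; [exact: clamp_le|exact: clamp_lip|
  exact: clamp_le|exact: clamp_lip|exact: clamp_le|exact: clamp_lip|
  exact: clamp_le|exact: clamp_lip].
Qed.
End Coercivity.

(** * Global existence of trajectories *)

Section Existence.
Variables (R : realType) (N : nat) (D : registration R N).
Hypothesis sigma_gt0 : forall i, 0 < sigma D i.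
Hypothesis mu_gt0 : 0 < mu D.
Hypothesis tgt_centered : tgt_center D = 0.
Hypothesis noncollinear : exists i j k : 'I_N,
  ~ collinear (src D i) (src D j) (src D k).
Local Notation J := (inertia D).

(** With the constant matrices [J] and [invmx J], the field is polynomial in the coordinates, so the
    closure lemmas follow its expression. *)
Lemma field_bounded_lip B k :
  bounded_lip (fun a => st_coord (vector_field D (truncate B a)) k).
Proof.
under [X in bounded_lip X]funext do rewrite vector_fieldE //.
have [Hp HQ Hv Hw] := truncate_bounded_lip B.
have HJw := mx_bounded_lipM (mx_bounded_lip_cst _ J) Hw.
case: k => [[[i|[i j]]|i]|i] /=.
- exact: Hv.
- exact: (mx_bounded_lipM HQ (mx_bounded_lip_skew Hw)).
- apply: (mx_bounded_lipD (mx_bounded_lipZ (- 2) Hp)).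
  exact: (mx_bounded_lipN (mx_bounded_lipZ (mu D) Hv)).
- apply: (mx_bounded_lipM (mx_bounded_lip_cst _ (invmx J))).
  apply: mx_bounded_lipD; last first.
    exact: (mx_bounded_lipN (mx_bounded_lipM (mx_bounded_lip_skew Hw) HJw)).
  apply: mx_bounded_lipD; last exact: (mx_bounded_lipN (mx_bounded_lipZ _ HJw)).
  apply: mx_bounded_lip_sum => m; apply: mx_bounded_lipZ.
  apply: mx_bounded_lipM; last exact: mx_bounded_lip_cst.
  apply: mx_bounded_lipM; first exact: mx_bounded_lip_cst.
  exact: mx_bounded_lip_tr.
Qed.

Lemma dissipation_bounded_lip B :
  bounded_lip (fun a => dissipation D (truncate B a)).
Proof.
have [_ _ Hv Hw] := truncate_bounded_lip B.
have HJw := mx_bounded_lipM (mx_bounded_lip_cst _ J) Hw.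
apply: bounded_lipM; first exact: bounded_lip_cst.
apply: bounded_lipD.
  apply: bounded_lipM; first exact: bounded_lip_cst.
  exact: (mx_bounded_lipM (mx_bounded_lip_tr Hv) Hv).
exact: (mx_bounded_lipM (mx_bounded_lip_tr Hw) HJw).
Qed.

(** For [B >= 0], a trapezoid: 1 up to [B], 0 beyond [B + 1], with slope 1 in between. *)
Definition cutoff (B r : R) : R := Num.max 0 (Num.min 1 (B + 1 - `|r|)).

Lemma cutoff_ge0 B r : 0 <= cutoff B r.
Proof. by rewrite /cutoff le_max lexx. Qed.

Lemma cutoff1 B r : `|r| <= B -> cutoff B r = 1.
Proof. by move=> H; rewrite /cutoff min_l ?max_r //; lra. Qed.

Lemma cutoff_supp B r : cutoff B r != 0 -> `|r| <= B + 1.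
Proof.
apply: contraNT; rewrite -ltNge => H.
by rewrite /cutoff min_r ?max_l //; lra.
Qed.

Lemma cutoff_le1 B r : `|cutoff B r| <= 1.
Proof.
by rewrite ger0_norm ?cutoff_ge0 // /cutoff ge_max ler01 ge_min lexx.
Qed.

Lemma cutoff_lip B r r' : `|cutoff B r - cutoff B r'| <= `|r - r'|.
Proof.
have H := ler_distD r' r 0; have H' := ler_distD r r' 0.
rewrite !subr0 in H H'; rewrite (distrC r' r) in H'.
rewrite /cutoff ler_norml.
case: (leP 1 (B + 1 - `|r|)) => ?; case: (leP 1 (B + 1 - `|r'|)) => ?;
  by do ?case: (leP 0 _) => ?; apply/andP; split; lra.
Qed.

Definition cutoff_all B (a : coord_index -> R) : R := \prod_k cutoff B (a k).

Lemma cutoff_all_ge0 B a : 0 <= cutoff_all B a.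
Proof. by apply: prodr_ge0 => k _; exact: cutoff_ge0. Qed.

Lemma cutoff_all1 B a : (forall k, `|a k| <= B) -> cutoff_all B a = 1.
Proof. by move=> H; rewrite /cutoff_all big1 // => k _; exact: cutoff1. Qed.

Lemma cutoff_all_bounded_lip B : bounded_lip (cutoff_all B).
Proof.
apply: bounded_lip_prod => k.
by apply: bounded_lip_coord; [exact: cutoff_le1|exact: cutoff_lip].
Qed.

(** Truncating one unit beyond [B] is invisible wherever the cutoff is nonzero, so the cut-off
    truncated field is a scalar multiple of the true field everywhere. *)
Lemma truncate_cutoffE B a : cutoff_all B a != 0 ->
  truncate (B + 1) a = of_coord a.
Proof.
move=> H; congr of_coord; apply/funext => k; rewrite clampK //.
apply: cutoff_supp; apply: contraNneq H => H.
by rewrite /cutoff_all (bigD1 k) //= H mul0r.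
Qed.

Lemma st_coordZ (c : R) (s : state R) k : st_coord (c *: s) k = c * st_coord s k.
Proof. by case: k => [[[i|[i j]]|i]|i] /=; rewrite mxE. Qed.

(* Multiplying the field by a cutoff only reparametrizes time, so the cut-off
   solution stays on the state space and its energy does not increase; hence it
   never leaves the region where the cutoff equals 1. *)
Lemma solution_exists s0 : state_space s0 ->
  exists s : R -> state R, s 0 = s0 /\ forall t : R, 0 <= t ->
    state_space (s t) /\ is_derive t 1 s (vector_field D (s t)).
Proof.
move=> s0S.
have [B HB] := coord_bounded sigma_gt0 noncollinear (energy D s0).
pose G a k := cutoff_all B a * st_coord (vector_field D (truncate (B + 1) a)) k.
have /choice[K HK] : forall k, bounded_lip (G^~ k).
  move=> k; apply: bounded_lipM; first exact: cutoff_all_bounded_lip.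
  exact: field_bounded_lip.
pose K' := 1 + \sum_k K k.
have KK' k : K k <= K'.
  rewrite /K' (bigD1 k) //= addrCA lerDl addr_ge0 //.
  by apply: sumr_ge0 => j _; have [] := HK j.
have K'0 : 0 < K' by rewrite ltr_pwDl // sumr_ge0 // => j _; have [] := HK j.
have [|a k|u [u0 du]] := @picard R coord_index G K' (st_coord s0) _ _ K'0.
- move=> a b r ab k; have r0 : 0 <= r by exact: le_trans (ab k).
  have [_ _ lip] := HK k; apply: le_trans (lip a b r r0 ab) _.
  by rewrite ler_wpM2r.
- by have [_ bd _] := HK k; exact: le_trans (bd a) (KK' k).
pose s t := of_coord (u t); pose c t := cutoff_all B (u t).
have ds (t : R) : 0 <= t -> is_derive t 1 s (c t *: vector_field D (s t)).
  move=> t0; apply/is_derive_coordP => k.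
  have -> : (fun r => st_coord (s r) k) = u^~ k.
    by apply/funext => r; rewrite /s of_coordK.
  apply: is_derive_eq (du t t0 k) _; rewrite /G -/(c t) st_coordZ.
  have [->|cn0] := eqVneq (c t) 0; first by rewrite !mul0r.
  by rewrite truncate_cutoffE.
have s00 : s 0 = s0 by rewrite /s u0 st_coordK.
have sS : forall t : R, 0 <= t -> state_space (s t).
  by apply: (@state_space_invariant _ _ _ _ _ _ _ c) => //; rewrite s00.
exists s; split=> // t t0; split; first exact: sS.
suff c1 : c t = 1 by have := ds t t0; rewrite c1 scale1r.
apply: cutoff_all1 => k; rewrite -(of_coordK (u t)); apply: HB; first exact: sS.
rewrite -s00 -subr_le0.
have [r /andP[r0 _]|r /andP[r0 _] ->] := @MVT_is_derive R
    (fun r => energy D (s r)) (fun r => - (c r * dissipation D (s r))) 0 t t0.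
  by apply: is_derive_energy => //; [exact: sS|exact: ds].
rewrite subr0 mulr_le0_ge0 // oppr_le0 mulr_ge0 //.
  exact: cutoff_all_ge0.
exact: dissipation_ge0.
Qed.

Lemma trajectory_exists s0 : state_space s0 ->
  exists s : R -> state R, trajectory D s0 s.
Proof.
move=> /solution_exists[s [s00 Hs]]; exists s; split=> //.
- by move=> t /Hs[].
(* The solution has a two-sided derivative at 0, which restricts to the one-sided quotient. *)
- have [_ /is_deriveP] := Hs 0 (lexx 0).
  under [X in X @ _ --> _]funext do rewrite addr0 [_ *: 1]mulr1.
  exact: cvg_dnbhs_at_right.
- by move=> t /ltW/Hs[].
Qed.
End Existence.

(** * Small values and nearby zeros; limits from quadratic bounds *)

Section NearZeros.
Variable R : realType.

(** Compactness of the box. Near a zero of [f] that zero itself serves as [b]; near any other point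
    [f] stays above half its value there, so [f a < d] fails for small [d]. A finite covering makes
    [d] uniform. *)
Lemma bounded_lip_near_zero (I : finType) (f : (I -> R) -> R) (B e : R) :
    bounded_lip f -> (forall a, 0 <= f a) -> 0 < e ->
  exists2 d : R, 0 < d & forall a, (forall k, `|a k| <= B) -> f a < d ->
    exists b, [/\ forall k, `|b k| <= B, f b = 0 & forall k, `|a k - b k| <= e].
Proof.
move=> [K [K0 _ lip]] f0 e0.
(* Families are transported to row vectors, where products of segments are known to be compact. *)
pose row a : 'rV[R]_#|I| := \row_i a (enum_val i).
pose fam (r : 'rV[R]_#|I|) k := r 0 (enum_rank k).
have famK a : fam (row a) = a.
  by apply/funext => k; rewrite /fam mxE enum_rankK.
pose box := [set r : 'rV[R]_#|I| | forall i, `[- B, B]%classic (r 0 i)].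
have cbox : compact box.
  by apply: (@rV_compact _ _ (fun=> `[- B, B]%classic)) => i; exact: segment_compact.
have boxP r : box r -> forall k, `|fam r k| <= B.
  by move=> rbox k; have := rbox (enum_rank k); rewrite /= in_itv /= ler_norml.
pose P (d : R) (r : 'rV[R]_#|I|) := f (fam r) < d ->
  exists b, [/\ forall k, `|b k| <= B, f b = 0 & forall k, `|fam r k - b k| <= e].
have near_fam r0 (h : R) : 0 < h ->
    \forall r \near r0, forall k, `|fam r k - fam r0 k| <= h.
  move=> h0; exists (fun i j => [set x | `|x - r0 i j| <= h]).
    move=> i j; near=> x; rewrite /= distrC; near: x.
    by apply: cvgr_dist_le => //; exact: cvg_id.
  by move=> r /= H k; exact: H.
have : \forall d \near 0^'+, box `<=` P d.
  apply: (compact_near_coveringP _).1 => // r0 r0box.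
  have [fr0|fr0] := eqVneq (f (fam r0)) 0.
    have nr := near_fam r0 e e0.
    near=> r d => /= _; exists (fam r0); split => //; first exact: boxP.
    exact: (near nr r).
  have c0 : 0 < f (fam r0) by rewrite lt_neqAle eq_sym fr0 f0.
  pose h := f (fam r0) / (2 * (K + 1)).
  have h0 : 0 < h by rewrite divr_gt0 // mulr_gt0 // ltr_wpDl.
  have nr := near_fam r0 h h0.
  have nd : \forall d \near (0 : R)^'+, d < f (fam r0) / 2.
    by apply: nbhs_right_lt; rewrite divr_gt0.
  near=> r d => /= fd; exfalso.
  have dc : d < f (fam r0) / 2 by exact: (near nd d).
  have /(lip _ _ _ (ltW h0)) : forall k, `|fam r k - fam r0 k| <= h.
    exact: (near nr r).
  have : K * h <= f (fam r0) / 2.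
    have -> : f (fam r0) / 2 = (K + 1) * h.
      by rewrite /h; field; rewrite gt_eqF // ltr_wpDl.
    by rewrite ler_pM2r // lerDl.
  by rewrite ler_norml => ? /andP[? _]; lra.
move=> /(filterI (nbhs_right_gt 0)) /filter_ex[d [d0 Hd]]; exists d => // a aB fa.
have := Hd (row a); rewrite /P famK; apply => // i.
by have := aB (enum_val i); rewrite /= in_itv /= ler_norml mxE.
Unshelve. all: by end_near. Qed.

(** The weighted bound replaces a square root: once [|g t| <= d * e] with [d * C <= e], applying it
    with weight [d] gives [|f t| <= e]. *)
Lemma cvg0_of_amgm (f g : R -> R) (C a : R) : 0 <= C ->
    (forall e t, a <= t -> 2 * e * `|f t| <= e ^+ 2 * C + g t) ->
    g t @[t --> +oo] --> 0 ->
  f t @[t --> +oo] --> 0.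
Proof.
move=> C0 H g0; apply/cvgrPdist_le => /= e e0.
have C1 : 0 < C + 1 by rewrite ltr_wpDl.
pose d := e / (C + 1); have d0 : 0 < d by rewrite divr_gt0.
have dC : d * C <= e.
  by rewrite /d mulrAC ler_pdivrMr // ler_pM2l // lerDl.
near=> t; rewrite sub0r normrN.
have at_ : a <= t by near: t; apply: nbhs_pinfty_ge; exact: num_real.
have gt : `|0 - g t| <= d * e.
  by near: t; move/cvgrPdist_le : g0; apply; rewrite mulr_gt0.
have := H d t at_; move: gt; rewrite sub0r normrN ler_norml => /andP[_ gt] ft.
have : d * (2 * `|f t|) <= d * (2 * e) by rewrite expr2 in ft; nra.
by rewrite ler_pM2l //; lra.
Unshelve. all: by end_near. Qed.

Lemma state_distE (s s' : state R) :
  state_dist s s' = Num.sqrt (\sum_k (st_coord s k - st_coord s' k) ^+ 2).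
Proof.
congr Num.sqrt; rewrite 3!big_sumType /= !l2norm_cV.
have dotB (u v : 'cV[R]_3) : dot (u - v) (u - v) = \sum_i (u i 0 - v i 0) ^+ 2.
  by rewrite dotE; apply: eq_bigr => i _; rewrite !mxE expr2.
rewrite !dotB; congr (_ + _ + _ + _).
rewrite /l2norm sqr_sqrtr; last by do 2 (rewrite sumr_ge0 // => ? _); exact: sqr_ge0.
by rewrite pair_bigA; apply: eq_bigr => -[i j] _; rewrite !mxE.
Qed.

End NearZeros.

(** * Decay of the defect and convergence to the equilibria *)

Section Convergence.
Variables (R : realType) (N : nat) (D : registration R N).
Hypothesis sigma_gt0 : forall i, 0 < sigma D i.
Hypothesis mu_gt0 : 0 < mu D.
Hypothesis tgt_centered : tgt_center D = 0.
Hypothesis noncollinear : exists i j k : 'I_N,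
  ~ collinear (src D i) (src D j) (src D k).
Local Notation M := (total_mass D).
Local Notation J := (inertia D).

(** The box also contains states whose matrix is not a rotation; this term makes a zero of the
    defect satisfy the constraint. *)
Definition constraint_defect (Q : 'M[R]_3) : R :=
  \sum_i \sum_j (Q^T *m Q - 1%:M) i j ^+ 2 + (\det Q - 1) ^+ 2.

(** The squares of [v] and [w] stand in for those of [p'] and [Q'], which vanish with them. *)
Definition defect (s : state R) : R :=
  constraint_defect (st_rot s) +
  \sum_i (st_angvel s i 0 ^+ 2 + st_vel s i 0 ^+ 2 +
          st_vel (vector_field D s) i 0 ^+ 2 +
          st_angvel (vector_field D s) i 0 ^+ 2).

Lemma constraint_defect_ge0 Q : 0 <= constraint_defect Q.
Proof.
rewrite addr_ge0 ?sqr_ge0 // sumr_ge0 // => i _.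
by apply: sumr_ge0 => j _; exact: sqr_ge0.
Qed.

Lemma constraint_defect_eq0 Q : constraint_defect Q = 0 <-> SO3 Q.
Proof.
have rows_ge0 i : 0 <= \sum_j (Q^T *m Q - 1%:M) i j ^+ 2.
  by apply: sumr_ge0 => j _; exact: sqr_ge0.
split=> [/eqP|[QtQ detQ]]; last first.
  rewrite /constraint_defect QtQ detQ !subrr expr0n /= addr0.
  by rewrite big1 // => i _; rewrite big1 // => j _; rewrite mxE expr0n.
rewrite paddr_eq0 ?sqr_ge0 ?sumr_ge0 // sqrf_eq0 subr_eq0 => /andP[H /eqP detQ].
split=> //; apply/matrixP => i j; apply/eqP; rewrite -subr_eq0.
move: H; rewrite psumr_eq0 // => /allP/(_ i); rewrite mem_index_enum => /(_ isT).
rewrite psumr_eq0 => [/allP/(_ j)|k _]; last exact: sqr_ge0.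
by rewrite mem_index_enum => /(_ isT); rewrite sqrf_eq0 !mxE.
Qed.

Lemma defect_ge0 s : 0 <= defect s.
Proof.
rewrite addr_ge0 ?constraint_defect_ge0 // sumr_ge0 // => i _.
by rewrite !addr_ge0 ?sqr_ge0.
Qed.

Lemma defect_eq0 s : defect s = 0 -> equilibria D s.
Proof.
have sq4 (a b c d : R) : 0 <= a ^+ 2 + b ^+ 2 + c ^+ 2 + d ^+ 2.
  by rewrite !addr_ge0 ?sqr_ge0.
move/eqP; rewrite paddr_eq0 ?constraint_defect_ge0 ?sumr_ge0 // => /andP[/eqP].
move=> /constraint_defect_eq0 sS; rewrite psumr_eq0 // => /allP H.
have {}H i : [/\ st_angvel s i 0 = 0, st_vel s i 0 = 0,
    st_vel (vector_field D s) i 0 = 0 & st_angvel (vector_field D s) i 0 = 0].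
  move: (H i); rewrite mem_index_enum => /(_ isT).
  rewrite !paddr_eq0 ?addr_ge0 ?sqr_ge0 // !sqrf_eq0.
  by move=> /andP[/andP[/andP[/eqP ? /eqP ?] /eqP ?] /eqP ?].
have w0 : st_angvel s = 0 by apply/colP => i; rewrite mxE; have [] := H i.
have v0 : st_vel s = 0 by apply/colP => i; rewrite mxE; have [] := H i.
split=> //; rewrite -(st_coordK (vector_field D s)) -(st_coordK 0).
congr of_coord; apply/funext => -[[[i|[i j]]|i]|i] /=.
- by rewrite -[LHS]/(st_vel s i 0) v0.
- by rewrite -[LHS]/((st_rot s *m skew (st_angvel s)) i j) w0 linear0 mulmx0.
- by have [_ _ -> _] := H i; rewrite -[RHS]/((0 : 'cV_3) i 0) mxE.
- by have [_ _ _ ->] := H i; rewrite -[RHS]/((0 : 'cV_3) i 0) mxE.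
Qed.

Lemma defect_bounded_lip B : bounded_lip (fun a => defect (truncate B a)).
Proof.
have [Hp HQ Hv Hw] := truncate_bounded_lip B.
have sq f : bounded_lip f -> bounded_lip (fun a : coord_index -> R => f a ^+ 2).
  by move=> ?; exact: bounded_lipM.
apply: bounded_lipD; last first.
  have field_lip := field_bounded_lip sigma_gt0 tgt_centered noncollinear B.
  apply: bounded_lip_sum => i; apply: bounded_lipD.
    apply: bounded_lipD; last exact: sq (field_lip (inl (inr i))).
    by apply: bounded_lipD; apply: sq; [exact: Hw|exact: Hv].
  exact: sq (field_lip (inr i)).
apply: bounded_lipD.
  apply: bounded_lip_sum => i; apply: bounded_lip_sum => j; apply: sq.
  apply: mx_bounded_lipD; last exact: mx_bounded_lip_cst.
  exact: (mx_bounded_lipM (mx_bounded_lip_tr HQ) HQ).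
apply: sq; apply: bounded_lipD; last exact: bounded_lip_cst.
(* The determinant is unfolded as its signed sum over permutations. *)
apply: bounded_lip_sum => sg; apply: bounded_lipM; first exact: bounded_lip_cst.
by apply: bounded_lip_prod => i; exact: HQ.
Qed.

Section Trajectory.
Variable s : R -> state R.
(** Starting at time 1 keeps away from time 0, where a trajectory has only a one-sided
    derivative. *)
Hypothesis sS : forall t : R, 1 <= t -> state_space (s t).
Hypothesis ds : forall t : R, 1 <= t -> is_derive t 1 s (vector_field D (s t)).

Lemma is_derive_energy_trajectory (t : R) : 1 <= t ->
  is_derive t 1 (fun r => energy D (s r)) (- dissipation D (s t)).
Proof.
move=> t1; rewrite -[dissipation D _]mul1r.
by apply: is_derive_energy => //; [exact: sS|rewrite scale1r; exact: ds].
Qed.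

Lemma trajectory_bounded : exists B : R, forall t : R, 1 <= t ->
  forall k, `|st_coord (s t) k| <= B.
Proof.
have [B HB] := coord_bounded sigma_gt0 noncollinear (energy D (s 1)).
exists B => t t1; apply: HB; first exact: sS.
rewrite -subr_le0.
have [r /andP[r1 _]|r _ ->] := @MVT_is_derive R
    (fun r => energy D (s r)) (fun r => - dissipation D (s r)) 1 t t1.
  exact: is_derive_energy_trajectory.
by rewrite mulr_le0_ge0 ?subr_ge0 // oppr_le0 dissipation_ge0.
Qed.

(** The field is bounded on the box, so every coordinate is Lipschitz in time, uniformly in the
    coordinate. *)
Lemma trajectory_lipschitz B f : bounded_lip f ->
    (forall t : R, 1 <= t -> forall k, `|st_coord (s t) k| <= B) ->
  exists K : R, forall t r : R, 1 <= t -> 1 <= r ->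
    `|f (st_coord (s t)) - f (st_coord (s r))| <= K * `|t - r|.
Proof.
move=> [K [K0 _ lip]] sB.
have /choice[L HL] := field_bounded_lip sigma_gt0 tgt_centered noncollinear B.
have L0 : 0 <= \sum_k L k by apply: sumr_ge0 => k _; have [] := HL k.
exists (K * \sum_k L k) => t r t1 r1; rewrite -mulrA; apply: lip.
  exact: mulr_ge0.
move=> k; apply: (@derive_bounded_lipschitz _ (fun t => st_coord (s t) k)
  (fun t => st_coord (vector_field D (s t)) k) _ 1) => // x x1.
  by have /is_derive_coordP := ds x1.
have [_ bd _] := HL k; have := bd (st_coord (s x)).
rewrite truncateK; last exact: sB.
move/le_trans; apply; rewrite (bigD1 k) //= lerDl.
by apply: sumr_ge0 => j _; have [] := HL j.
Qed.

Lemma defect_cvg0 : defect (s t) @[t --> +oo] --> 0.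
Proof.
have [B sB] := trajectory_bounded.
have lip f : bounded_lip (fun a => f (truncate B a)) -> exists K : R,
    forall t r : R, 1 <= t -> 1 <= r -> `|f (s t) - f (s r)| <= K * `|t - r|.
  move=> /trajectory_lipschitz/(_ sB)[K HK]; exists K => t r t1 r1.
  by have := HK t r t1 r1; rewrite !truncateK //; [exact: sB|exact: sB].
have [E HE] : exists E : R, energy D (s t) @[t --> +oo] --> E.
  apply: (antitone_bounded_cvg is_derive_energy_trajectory) => [t _|t _].
    by rewrite oppr_le0 dissipation_ge0.
  exact: energy_ge0.
(* First use of [derive_cvg0]: the energy converges and its derivative is Lipschitz in time. *)
have diss0 : dissipation D (s t) @[t --> +oo] --> 0.
  have [K HK] := lip _ (dissipation_bounded_lip D B).
  have := derive_cvg0 is_derive_energy_trajectory _ HE.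
  move=> /(_ K) H; rewrite -[0]oppr0.
  under eq_fun do rewrite -[dissipation D _]opprK.
  apply: cvgN; apply: H => t r t1 r1.
  by rewrite -opprD normrN; exact: HK.
have M0 := total_mass_gt0 sigma_gt0 noncollinear.
have muM0 : 0 < mu D * M by exact: mulr_gt0.
have Jw0 t := inertia_form_ge0 sigma_gt0 (st_angvel (s t)).
have vv0 t := dot_ge0 (st_vel (s t)).
have v0 i : st_vel (s t) i 0 @[t --> +oo] --> 0.
  apply: (@cvg0_of_amgm _ _
    (fun t => (mu D * M)^-1 * dissipation D (s t)) 1 1) => //.
    move=> e t _; have := sqr_coord_le_dot (st_vel (s t)) i.
    have : dot (st_vel (s t)) (st_vel (s t)) <= (mu D * M)^-1 * dissipation D (s t).
      rewrite ler_pdivlMl // /dissipation mulrDr mulrA lerDl.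
      exact: mulr_ge0 (ltW _) _.
    have := sqr_ge0 (e - `|st_vel (s t) i 0|).
    (* The square of the coordinate becomes the square of its absolute value, to match the other
       inequality for [lra]. *)
    rewrite -[_ ^+ 2 <= dot _ _](congr1 (fun x => x <= _) (real_normK (num_real _))).
    rewrite mulr1; lra.
  by rewrite -[0](mulr0 (mu D * M)^-1); apply: cvgMr.
have w0 i : st_angvel (s t) i 0 @[t --> +oo] --> 0.
  have [C C0 HC] := angvel_coord_le sigma_gt0 noncollinear i.
  apply: (@cvg0_of_amgm _ _ (fun t => (mu D)^-1 * dissipation D (s t)) C 1) => //.
    move=> e t _; apply: le_trans (HC _ _) _; rewrite lerD2l /dissipation.
    rewrite mulKf ?gt_eqF // lerDr; exact: mulr_ge0 (ltW _) _.
  by rewrite -[0](mulr0 (mu D)^-1); apply: cvgMr.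
(* Second use of [derive_cvg0]: a coordinate of the field is the time derivative of that coordinate
   of the state. *)
have dcoord0 k : st_coord (s t) k @[t --> +oo] --> 0 ->
    st_coord (vector_field D (s t)) k @[t --> +oo] --> 0.
  have [K HK] := lip (fun s => st_coord (vector_field D s) k)
    (field_bounded_lip sigma_gt0 tgt_centered noncollinear B k).
  apply: (derive_cvg0 _ HK) => t t1.
  by have /is_derive_coordP := ds t1.
have sq0 (f : R -> R) : f t @[t --> +oo] --> 0 -> f t ^+ 2 @[t --> +oo] --> 0.
  by move=> H; rewrite -[0](mulr0 0); apply: cvgM.
pose rate i t := st_angvel (s t) i 0 ^+ 2 + st_vel (s t) i 0 ^+ 2 +
  st_vel (vector_field D (s t)) i 0 ^+ 2 +
  st_angvel (vector_field D (s t)) i 0 ^+ 2.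
have rate0 i : rate i t @[t --> +oo] --> 0 + 0 + 0 + 0.
  apply: cvgD; last by apply: sq0; exact: (dcoord0 (inr i) (w0 i)).
  apply: cvgD; last by apply: sq0; exact: (dcoord0 (inl (inr i)) (v0 i)).
  by apply: cvgD; apply: sq0.
have : rate 0 t + rate 1 t + rate 2 t @[t --> +oo] --> (0 : R).
  have := cvgD (cvgD (rate0 0) (rate0 1)) (rate0 2).
  by rewrite !addr0; apply.
apply: cvg_trans; apply: near_eq_cvg; near=> t.
rewrite /defect sum_ord3 (constraint_defect_eq0 _).2 ?add0r //; apply: sS.
by near: t; apply: nbhs_pinfty_ge; exact: num_real.
Unshelve. all: by end_near. Qed.

Lemma trajectory_cvg :
  state_dist_set (s t) (equilibria D) @[t --> +oo%R] --> 0%E.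
Proof.
have [B sB] := trajectory_bounded.
pose I : finType := coord_index; pose n : R := #|I|%:R.
have near_eq (e : R) : 0 < e -> \forall t \near +oo, exists2 a,
    equilibria D a & state_dist (s t) a <= e.
  (* A distance of [e'] in each of the [n] coordinates gives at most [Num.sqrt n * e' <= e] in the
     Euclidean norm; adding 1 keeps the denominator positive. *)
  move=> e0; pose e' := e / (Num.sqrt n + 1).
  have sq1 : 0 < Num.sqrt n + 1 by rewrite ltr_wpDl // sqrtr_ge0.
  have e'0 : 0 < e' by rewrite divr_gt0.
  have [|d d0 Hd] := @bounded_lip_near_zero R I
    (fun a => defect (truncate B a)) B e' (defect_bounded_lip B) _ e'0.
    by move=> a; exact: defect_ge0.
  near=> t.
  have t1 : 1 <= t by near: t; apply: nbhs_pinfty_ge; exact: num_real.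
  have dt : defect (s t) < d.
    near: t; have /cvgrPdist_lt/(_ d d0) := defect_cvg0.
    by apply: filterS => t; rewrite sub0r normrN; exact/le_lt_trans/ler_norm.
  have [|b [bB db ab]] := Hd (st_coord (s t)) (sB t t1).
    by rewrite truncateK //; exact: sB.
  exists (of_coord b).
    (* The zero [b] lies in the box, so truncation does not change it and the true defect vanishes
       there. *)
    by apply: defect_eq0; rewrite -db -(of_coordK b) truncateK ?of_coordK.
  rewrite state_distE of_coordK; apply: (@le_trans _ _ (Num.sqrt n * e')).
    have -> : Num.sqrt n * e' = Num.sqrt (n * e' ^+ 2).
      by rewrite sqrtrM ?ler0n // sqrtr_sqr ger0_norm // ltW.
    rewrite ler_sqrt; last by apply: mulr_ge0; [exact: ler0n|exact: sqr_ge0].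
    rewrite /n -sum1_card natr_sum mulr_suml; apply: ler_sum => k _.
    rewrite mul1r -[leLHS]real_normK ?num_real // ler_sqr ?nnegrE ?(ltW e'0) //.
  by rewrite /e' mulrA ler_pdivrMr // mulrC ler_pM2l // lerDl.
have dist_ge0 t : (0 <= state_dist_set (s t) (equilibria D))%E.
  by apply/ereal_infP => _ [a _ <-]; rewrite lee_fin sqrtr_ge0.
have dist_le (e : R) : 0 < e -> \forall t \near +oo,
    (state_dist_set (s t) (equilibria D) <= e%:E)%E.
  move=> /near_eq; apply: filterS => t [a aE ae].
  apply: ge_ereal_inf; exists (state_dist (s t) a)%:E; first by exists a.
  by rewrite lee_fin.
(* Convergence in the extended reals reduces to real convergence once the distance is eventually
   finite, here at most 1. *)
have fin t : (state_dist_set (s t) (equilibria D) <= 1%:E)%E ->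
    state_dist_set (s t) (equilibria D) \is a fin_num.
  by move=> le1; rewrite ge0_fin_numE // (le_lt_trans le1) ?ltry.
apply/fine_cvgP; split.
  by have := dist_le 1 ltr01; apply: filterS => t; exact: fin.
apply/cvgrPdist_le => e e0; near=> t.
rewrite sub0r normrN /= ger0_norm ?fine_ge0 // -lee_fin fineK.
  by near: t; exact: dist_le.
by apply: fin; near: t; exact: dist_le.
Unshelve. all: by end_near. Qed.

End Trajectory.
End Convergence.

Theorem proposition4 (R : realType) (N : nat) (D : registration R N)
    (sigma_gt0 : forall i : 'I_N, 0 < sigma D i)
    (mu_gt0 : 0 < mu D)
    (tgt_centered : tgt_center D = 0)
    (src_noncollinear : exists i j k : 'I_N,
       ~ collinear (src D i) (src D j) (src D k)) :
  [/\ forall s : state R, state_space s ->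
        let t := st_pos s - st_rot s *m src_center D in
        potential_energy D s =
          \sum_i 1 / sigma D i ^+ 2
                 * l2norm (tgt D i - st_rot s *m src D i - t) ^+ 2,
      forall s0 : state R, state_space s0 ->
        (exists s : R -> state R, trajectory D s0 s) /\
        (forall s : R -> state R, trajectory D s0 s ->
           state_dist_set (s tau) (equilibria D) @[tau --> +oo%R] --> 0%E) &
      forall s : state R, equilibria D s ->
        [/\ force D s = 0, torque D s = 0,
            st_pos s = tgt_center D & st_pos s = 0]].
Proof.
split=> [s sS|s0 s0S|s /(equilibriaP sigma_gt0 tgt_centered src_noncollinear)].
- exact: potential_energyE.
- split; first exact: trajectory_exists.
  move=> s [_ sS _ ds]; apply: trajectory_cvg => // t t1.
    by apply: sS; exact: le_trans t1.
  by apply: ds; exact: lt_le_trans t1.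
- move=> [sS [p0 v0 w0 T0]]; split=> //; last by rewrite tgt_centered.
  + by rewrite forceE // p0 v0 !scaler0 subrr.
  + by rewrite torqueE // T0 w0 mulmx0 scaler0 subrr.
Qed.
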